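(* Let $\alpha>0$, $\varphi(z)=\alpha(\log^+|z|)^2$, $\Gamma=\{-i\,e^{\frac{n+1}{2\alpha}}\}_{n\ge0}$ and $G(z)=\prod_{\gamma\in\Gamma}\left(1-\frac z\gamma\right)$. Then the space $\mathcal{F}^2_\varphi$ is a de Branges space: $\mathcal{F}^2_\varphi=\mathcal{H}(G)$ (with equivalent norms).
   Context: Here $\log^+ t=\max(\log t,0)$ and $m$ is planar Lebesgue measure. $\mathcal{F}^2_\varphi$ is the Hilbert space of entire functions $f$ with $\|f\|_{\varphi,2}^2=\int_{\mathbb{C}}|f|^2e^{-2\varphi}\,dm<\infty$. The product defining $G$ converges uniformly on compact sets. The de Branges space of $G$ is $\mathcal{H}(G)=\{f\text{ entire}: f/G\in H^2(\mathbb{C}^+)\text{ and }f^*/G\in H^2(\mathbb{C}^+)\}$, where $f^*(z)=\overline{f(\bar z)}$ and $H^2(\mathbb{C}^+)$ is the Hardy space of the upper half-plane; its norm is $\|f\|_{\mathcal{H}(G)}^2=\int_{\mathbb{R}}|f(x)/G(x)|^2\,dx$. *)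

(* Defs.v *)
From HB Require Import structures.
From mathcomp Require Import all_boot all_order all_algebra.
From mathcomp Require Import all_classical all_reals all_analysis.
From mathcomp Require Export complex.

Set Implicit Arguments.
Unset Strict Implicit.
Unset Printing Implicit Defensive.

Import Order.TTheory GRing.Theory Num.Theory.
Import numFieldNormedType.Exports.

Local Open Scope classical_set_scope.
Local Open Scope ring_scope.
Local Open Scope complex_scope.

(* [R[i]^o] is [R[i]] seen as a normed space over itself: it carries the usual
   topology of the plane, and derivability in the direction [1] with scalars
   in [R[i]] is complex differentiability. *)
Definition holomorphic_at (R : realType) (f : R[i] -> R[i]) (z : R[i]) : Prop :=
  derivable (f : R[i]^o -> R[i]^o) (z : R[i]^o) 1.

Definition entire (R : realType) (f : R[i] -> R[i]) : Prop :=
  forall z, holomorphic_at f z.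

(* The real-valued modulus; the library's [`|z|] lives in [R[i]]. *)
Definition cabs (R : realType) (z : R[i]) : R := ComplexField.Normc.normc z.

(* [ln 0 = 0] in the library, so [logplus 0 = 0]. *)
Definition logplus (R : realType) (t : R) : R := Num.max (ln t) 0.

(* The plane is identified with [R * R], planar Lebesgue measure being the
   product measure. The norm is valued in [\bar R] and is [+oo] exactly when
   the integral diverges. *)
Definition fock_norm (R : realType) (phi : R[i] -> R) (f : R[i] -> R[i])
    : \bar R :=
  sqrte (\int[(@lebesgue_measure R \x @lebesgue_measure R)%E]_p
    (cabs (f (p.1 +i* p.2)) ^+ 2 * expR (- (2 * phi (p.1 +i* p.2))))%:E)%E.

Definition fock_space (R : realType) (phi : R[i] -> R) : set (R[i] -> R[i]) :=
  [set f | entire f /\ (fock_norm phi f < +oo)%E].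

(* The Hardy space of the open upper half-plane, as a set of functions on the
   plane whose values outside that half-plane are irrelevant. *)
Definition hardy_space (R : realType) : set (R[i] -> R[i]) :=
  [set g | (forall z, 0 < complex.Im z -> holomorphic_at g z) /\
    exists M : R, forall y : R, 0 < y ->
      (\int[@lebesgue_measure R]_x (cabs (g (x +i* y)) ^+ 2)%:E <= M%:E)%E].

Definition sharp (R : realType) (f : R[i] -> R[i]) : R[i] -> R[i] :=
  fun z => conjc (f (conjc z)).

Definition de_branges (R : realType) (G : R[i] -> R[i]) : set (R[i] -> R[i]) :=
  [set f | [/\ entire f,
    hardy_space (fun z => f z / G z) &
    hardy_space (fun z => sharp f z / G z)]].

Definition de_branges_norm (R : realType) (G f : R[i] -> R[i]) : \bar R :=
  sqrte (\int[@lebesgue_measure R]_x (cabs (f x%:C / G x%:C) ^+ 2)%:E)%E.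

Definition equivalent_norms_on (R : realType) (T : Type) (V : set T)
    (N1 N2 : T -> \bar R) : Prop :=
  exists c C : R, [/\ 0 < c, 0 < C &
    forall f, V f -> (c%:E * N2 f <= N1 f)%E /\ (N1 f <= C%:E * N2 f)%E].

Definition weight (R : realType) (alpha : R) (z : R[i]) : R :=
  alpha * logplus (cabs z) ^+ 2.

Definition gamma_pt (R : realType) (alpha : R) (n : nat) : R[i] :=
  0 -i* expR (n.+1%:R / (2 * alpha)).

(* [gamma_pt alpha] is injective, so the product over the set of its values is
   the product over [n], taken as the limit of the partial products. *)
Definition genfun (R : realType) (alpha : R) (z : R[i]) : R[i] :=
  lim ((\prod_(n < N) (1 - z / gamma_pt alpha n) : R[i]^o) @[N --> \oo]).

(* Main.v *)
Require Import Defs.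
From HB Require Import structures.
From mathcomp Require Import all_boot all_order all_algebra.
From mathcomp Require Import all_classical all_reals all_analysis.
From mathcomp Require Import measurable_realfun zify ring lra.

(* Write q = e^(1/(2 alpha)), so that the zeros of G are - i q^(n+1), and cut the
   plane into the rings q^k <= |z| <= q^(k+1), the first one being completed by
   the unit disc. On the k-th ring e^(2 phi) is comparable to
   |z|^(2k) q^(- k^2), and on its upper half |G|^2 is comparable to
   |z|^(2k) q^(- k (k+1)); hence |f|^2 e^(- 2 phi) is comparable to
   |f / G|^2 / q^k there.

   Both inclusions rest on the reflection inequality obtained by applying
   Goursat's theorem to F(z) conj(F(z')), with z' the mirror image of z in a
   line L: this function is |F|^2 on L, so the integral of |F|^2 over a segment
   of L is bounded by the integrals of |F|^2 over parallel segments and over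
   the connecting sides.

   From H(G) to the Fock space: averaging over large rectangles gives the
   Fejer-Riesz inequality, bounding the integral of |F|^2 over vertical
   half-lines by its integral over the real line. It is applied to F = f g_k / G
   with g_k a rational function localizing to the k-th ring, and the sum of
   the |g_k|^2 is bounded on the real line.

   From the Fock space to H(G): averaging over rectangles of size q^k bounds the
   integral of |f / z^k|^2 over the part of a horizontal line inside the k-th
   ring by its area integral over a slightly larger ring, uniformly in the
   height of the line. *)

Set Implicit Arguments.
Unset Strict Implicit.
Unset Printing Implicit Defensive.
Import Order.TTheory GRing.Theory Num.Theory.
Import numFieldNormedType.Exports.
Local Open Scope classical_set_scope.
Local Open Scope ring_scope.
Local Open Scope complex_scope.


(** The reflection inequality needs nothing beyond Goursat's theorem and takes the place of the
    subharmonicity of [|F|^2] and of the theory of boundary values in Hardy spaces.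

    [G] vanishes only on the negative imaginary axis, so [f / G] is under control on the closed
    upper half-plane but not below it; the lower half-plane is reached through [sharp f]. In the
    converse direction the rectangles around a horizontal line may contain zeros of [G], which is
    why [f / z^k] is averaged there instead of [f / G].

    The factor [q^k] that separates [|G|^2] from [e^(2 phi)] on the [k]-th ring is the width of that
    ring, that is, the factor between an area integral and a line integral.

    A Hardy bound is uniform in the height but gives no decay, whereas the top side of the large
    rectangles must disappear in the limit: the localizers also supply a decay [1 / (1 + y^2)]. The
    Hardy bound itself enters only such limits, so the resulting estimate involves the real-line
    integral alone, as the equivalence of norms requires. *)

Section complex_modulus.
Context {R : realType}.
Implicit Types (z w : R[i]) (f g : R[i] -> R[i]).

Lemma cabs_norm z : `|z| = (cabs z)%:C.
Proof. by case: z. Qed.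

Lemma cabs_ge0 z : 0 <= cabs z.
Proof. by case: z => a b; exact: sqrtr_ge0. Qed.

Lemma cabsD z w : cabs (z + w) <= cabs z + cabs w.
Proof. by rewrite -lecR rmorphD/= -!cabs_norm ler_normD. Qed.

Lemma cabsM z w : cabs (z * w) = cabs z * cabs w.
Proof. exact: ComplexField.Normc.normcM. Qed.

Lemma cabsV z : cabs z^-1 = (cabs z)^-1.
Proof. exact: ComplexField.Normc.normcV. Qed.

Lemma cabsN z : cabs (- z) = cabs z.
Proof. by case: z => a b; rewrite /cabs/= !sqrrN. Qed.

Lemma cabsJ z : cabs (conjc z) = cabs z.
Proof. by case: z => a b; rewrite /cabs/= sqrrN. Qed.

Lemma cabs0 : cabs (0 : R[i]) = 0.
Proof. exact: ComplexField.Normc.normc0. Qed.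

Lemma cabs1 : cabs (1 : R[i]) = 1.
Proof. exact: ComplexField.Normc.normc1. Qed.

Lemma cabsX z n : cabs (z ^+ n) = cabs z ^+ n.
Proof.
by elim: n => [|n IH]; rewrite ?expr0 ?cabs1// !exprS cabsM IH.
Qed.

Lemma cabs_eq0 z : (cabs z == 0) = (z == 0).
Proof.
apply/eqP/eqP => [|->]; last exact: cabs0.
exact: ComplexField.Normc.eq0_normc.
Qed.

Lemma cabs_gt0 z : (0 < cabs z) = (z != 0).
Proof. by rewrite lt_def cabs_ge0 andbT cabs_eq0. Qed.

Lemma sqr_cabs z : cabs z ^+ 2 = complex.Re z ^+ 2 + complex.Im z ^+ 2.
Proof.
by case: z => a b; rewrite /cabs/= sqr_sqrtr// addr_ge0 ?sqr_ge0.
Qed.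

Lemma cabs_real (x : R) : cabs x%:C = `|x|.
Proof. by rewrite /cabs/= expr0n addr0 sqrtr_sqr. Qed.

Lemma ler_Re_cabs z : `|complex.Re z| <= cabs z.
Proof.
rewrite -ler_sqr ?nnegrE ?cabs_ge0// real_normK ?num_real// sqr_cabs.
by rewrite lerDl sqr_ge0.
Qed.

Lemma ler_Im_cabs z : `|complex.Im z| <= cabs z.
Proof.
rewrite -ler_sqr ?nnegrE ?cabs_ge0// real_normK ?num_real// sqr_cabs.
by rewrite lerDr sqr_ge0.
Qed.

Lemma cabs_le_ReIm z : cabs z <= `|complex.Re z| + `|complex.Im z|.
Proof.
rewrite -ler_sqr ?nnegrE ?cabs_ge0 ?addr_ge0// sqr_cabs sqrrD.
rewrite !real_normK ?num_real// [leRHS]addrAC.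
by rewrite lerDl mulrn_wge0 ?mulr_ge0.
Qed.

Lemma ReB z w : complex.Re (z - w) = complex.Re z - complex.Re w.
Proof. by case: z w => ? ? []. Qed.

Lemma ImB z w : complex.Im (z - w) = complex.Im z - complex.Im w.
Proof. by case: z w => ? ? []. Qed.

End complex_modulus.

(** * Complex differentiability through real error estimates *)

Section complex_derivative.
Context {R : realType}.
Implicit Types (z w : R[i]) (f g : R[i] -> R[i]).

(** The error is compared with [e * cabs w] instead of being divided by [w]: estimates stay among
    real numbers and [w = 0] is no special case. *)
Definition cdiff f z := exists l, forall e : R, 0 < e ->
  exists2 d, 0 < d & forall w, cabs w < d ->
    cabs (f (z + w) - f z - l * w) <= e * cabs w.

Let diff_quot_err (A l w : R[i]) : w != 0 ->
  l - w^-1 * A = - (w^-1 * (A - l * w)).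
Proof. by move=> w0; field. Qed.

Lemma cdiffP f z : cdiff f z <-> holomorphic_at f z.
Proof.
split.
- case=> l fl; apply/cvg_ex; exists (l : R[i]^o).
  apply/cvgrPdist_le => /= e e0.
  have [er e0'] : e = (complex.Re e)%:C /\ 0 < complex.Re e.
    by case: e e0 => a b /=; rewrite ltcE/= => /andP[/eqP -> ->].
  have [d d0 fd] := fl _ e0'.
  exists d%:C => /=; first by rewrite ltcR.
  move=> w /=; rewrite sub0r normrN => wd w0.
  rewrite er cabs_norm lecR.
  rewrite [X in cabs X](_ : _ = - (w^-1 * (f (z + w) - f z - l * w))); last first.
    rewrite /GRing.scale/= mulr1 [w + z]addrC; exact: diff_quot_err.
  rewrite cabsN cabsM cabsV mulrC ler_pdivrMr ?cabs_gt0//.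
  by apply: fd; rewrite -ltcR -cabs_norm.
- move=> /cvg_ex[l] /cvgrPdist_le/= fl; exists l => e e0.
  have [|/= d d0 fd] := fl e%:C; first by rewrite ltcR.
  have d0' : 0 < complex.Re d.
    by case: d d0 {fd} => a b /=; rewrite ltcE/= => /andP[].
  have dr : d = (complex.Re d)%:C.
    by case: d d0 {fd d0'} => a b /=; rewrite ltcE/= => /andP[/eqP ->].
  exists (complex.Re d) => // w wd.
  have [->|w0] := eqVneq w 0; first by rewrite addr0 subrr mulr0 subr0 cabs0 mulr0.
  have := fd w; rewrite /= sub0r normrN cabs_norm dr ltcR => /(_ wd w0).
  rewrite cabs_norm lecR.
  rewrite [X in cabs X](_ : _ = - (w^-1 * (f (z + w) - f z - l * w))); last first.
    rewrite /GRing.scale/= mulr1 [w + z]addrC; exact: diff_quot_err.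
  by rewrite cabsN cabsM cabsV mulrC ler_pdivrMr ?cabs_gt0.
Qed.

Lemma cdiff_cst c z : cdiff (fun=> c) z.
Proof. exact/(cdiffP _ _).2/derivable_cst. Qed.

Lemma cdiff_id z : cdiff id z.
Proof. exact/(cdiffP _ _).2/derivable_id. Qed.

Lemma cdiffD f g z : cdiff f z -> cdiff g z -> cdiff (fun w => f w + g w) z.
Proof.
move=> /(cdiffP _ _).1 fz /(cdiffP _ _).1 gz; apply: (cdiffP _ _).2.
exact: (@derivableD R[i] R[i]^o R[i]^o f g z 1 fz gz).
Qed.

Lemma cdiffM f g z : cdiff f z -> cdiff g z -> cdiff (fun w => f w * g w) z.
Proof.
move=> /(cdiffP _ _).1 fz /(cdiffP _ _).1 gz; apply: (cdiffP _ _).2.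
exact: (@derivableM R[i] R[i]^o f g z 1 fz gz).
Qed.

Lemma cdiffV f z : f z != 0 -> cdiff f z -> cdiff (fun w => (f w)^-1) z.
Proof.
move=> fz0 /(cdiffP _ _).1 fz; apply: (cdiffP _ _).2.
exact: (@derivableV R[i] R[i]^o f z 1 fz0 fz).
Qed.

Lemma cdiffX f n z : cdiff f z -> cdiff (fun w => f w ^+ n) z.
Proof.
move=> fz; elim: n => [|n IH]; first exact: cdiff_cst.
by rewrite (_ : (fun _ => _) = fun w => f w * f w ^+ n);
  [exact: cdiffM|apply/funext => w; rewrite exprS].
Qed.

Lemma cdiff_conj f z :
  cdiff f (conjc z) -> cdiff (fun w => conjc (f (conjc w))) z.
Proof.
case=> l fl; exists (conjc l) => e e0.
have [d d0 fd] := fl _ e0; exists d => // w wd.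
have := fd (conjc w); rewrite cabsJ => /(_ wd).
by rewrite -cabsJ !rmorphB/= rmorphM/= conjcK rmorphD.
Qed.

Lemma cdiff_affine f a b z :
  cdiff f (a * z + b) -> cdiff (fun w => f (a * w + b)) z.
Proof.
case=> l fl; exists (l * a) => e e0.
have a1 : 0 < cabs a + 1 by rewrite ltr_wpDl// cabs_ge0.
have [d d0 fd] := fl _ (divr_gt0 e0 a1).
exists (d / (cabs a + 1)); first exact: divr_gt0.
move=> w wd.
have := fd (a * w); rewrite cabsM.
have -> : a * z + b + a * w = a * (z + w) + b by ring.
rewrite mulrA => /(_ _)/le_trans; apply.
  move: wd; rewrite ltr_pdivlMr//; apply: le_lt_trans.
  by rewrite mulrC ler_wpM2l ?cabs_ge0// lerDl.
rewrite mulrA ler_wpM2r ?cabs_ge0// mulrAC ler_pdivrMr//.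
by rewrite ler_wpM2l ?ltW// ltrDl.
Qed.

Lemma cdiff_continuous f z : cdiff f z ->
  forall e : R, 0 < e -> exists2 d, 0 < d & forall w, cabs w < d ->
    cabs (f (z + w) - f z) <= e.
Proof.
case=> l /(_ _ ltr01)[d d0 fd] e e0.
have l1 : 0 < cabs l + 1 by rewrite ltr_wpDl// cabs_ge0.
exists (Num.min d (e / (cabs l + 1))); first by rewrite lt_min d0/= divr_gt0.
move=> w; rewrite lt_min ltr_pdivlMr// => /andP[wd we].
rewrite -[X in cabs X](subrK (l * w)) (le_trans (cabsD _ _))//.
apply: le_trans (ltW we); rewrite mulrDr mulr1 addrC lerD//.
  by rewrite cabsM mulrC.
by have := fd _ wd; rewrite mul1r.
Qed.

End complex_derivative.

(** * Integrals of continuous functions over segments *)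

Section segment_integral.
Context {R : realType}.
Implicit Types (f g : R -> R) (a b : R).
Local Notation mu := (@lebesgue_measure R).

(** Continuity is two-sided even at the endpoints, so it passes at once to subsegments. *)
Definition seg_continuous g a b := forall x, a <= x <= b -> {for x, continuous g}.

Lemma seg_integrable g a b :
  seg_continuous g a b -> mu.-integrable `[a, b] (EFin \o g).
Proof.
move=> cg; apply: continuous_compact_integrable; first exact: segment_compact.
by apply: continuous_in_subspaceT => x; rewrite inE/= in_itv/= => /cg.
Qed.

Lemma seg_continuous_sub g a b a' b' :
  a <= a' -> b' <= b -> seg_continuous g a b -> seg_continuous g a' b'.
Proof. by move=> aa bb cg x /andP[ax xb]; apply: cg; lra. Qed.

Lemma seg_continuousB f g a b : seg_continuous f a b -> seg_continuous g a b ->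
  seg_continuous (fun x => f x - g x) a b.
Proof. by move=> cf cg x xab; apply: cvgB; [exact: cf|exact: cg]. Qed.

Lemma Rintegral_split g a m b : a <= m -> m <= b -> seg_continuous g a b ->
  \int[mu]_(x in `[a, b]) g x =
  \int[mu]_(x in `[a, m]) g x + \int[mu]_(x in `[m, b]) g x.
Proof.
move=> am mb cg; apply/eqP; rewrite addrC -subr_eq; apply/eqP.
rewrite (Rintegral_itvB (seg_integrable cg)) ?bnd_simp//.
rewrite Rintegral_itv_obnd_cbnd//.
apply: integrableS (seg_integrable cg) => //.
by move=> x /=; rewrite !in_itv/= => /andP[mx ->]; rewrite andbT; lra.
Qed.

Lemma Rintegral_near_cst g a b k e : a <= b -> seg_continuous g a b ->
  (forall x, a <= x <= b -> `|g x - k| <= e) ->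
  `|\int[mu]_(x in `[a, b]) g x - k * (b - a)| <= e * (b - a).
Proof.
move=> ab cg ge.
have lab : fine (mu `[a, b]%classic) = b - a.
  rewrite lebesgue_measure_itv/= lte_fin; case: ltP => //= ba.
  by apply/esym/eqP; rewrite subr_eq0 eq_le ba ab.
have ck : seg_continuous (fun=> k) a b by move=> x _; exact: cvg_cst.
have ce : seg_continuous (fun=> e) a b by move=> x _; exact: cvg_cst.
rewrite -[in X in `|_ - X|]lab -Rintegral_cst// -RintegralB//;
  try exact: seg_integrable.
have cgk := seg_continuousB cg ck.
apply: le_trans (le_normr_Rintegral _ (seg_integrable cgk)) _ => //.
rewrite -[in leRHS]lab -Rintegral_cst//; apply: le_Rintegral => //.
- apply: (seg_integrable (g := fun x => `|g x - k|)) => x xab.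
  by apply: cvg_norm; exact: cgk.
- exact: seg_integrable.
Qed.

End segment_integral.

(** * Goursat's theorem on rectangles *)

Section goursat.
Context {R : realType}.
Implicit Types (f : R[i] -> R[i]) (a b c d e : R).
Local Notation mu := (@lebesgue_measure R).

Lemma cdiff_Re_horizontal f (x y : R) : cdiff f (x +i* y) ->
  {for x, continuous (fun t => complex.Re (f (t +i* y)))}.
Proof.
move=> /cdiff_continuous fz; apply/cvgrPdist_le => /= e e0.
have [d d0 fd] := fz _ e0; exists d => //= t; rewrite /ball_/= distrC => xt.
have := fd ((t - x)%:C); rewrite cabs_real => /(_ xt).
rewrite [in X in f X - _](_ : _ + _ = t +i* y); last by congr Complex => /=; ring.
by apply: le_trans; rewrite distrC -ReB ler_Re_cabs.
Qed.

Lemma cdiff_mul_i f z : cdiff f z -> cdiff (fun w => - 'i * f w) z.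
Proof. by move=> fz; apply: cdiffM => //; exact: cdiff_cst. Qed.

Lemma cdiff_Im_vertical f (x y : R) : cdiff f (x +i* y) ->
  {for y, continuous (fun t => complex.Im (f (x +i* t)))}.
Proof.
move=> /cdiff_continuous fz; apply/cvgrPdist_le => /= e e0.
have [d d0 fd] := fz _ e0; exists d => //= t; rewrite /ball_/= distrC => yt.
have := fd (0 +i* (t - y)); rewrite {1}/cabs/= expr0n add0r sqrtr_sqr => /(_ yt).
rewrite [in X in f X - _](_ : _ + _ = x +i* t); last by congr Complex => /=; ring.
by apply: le_trans; rewrite distrC -ImB ler_Im_cabs.
Qed.

(* The real part of the integral of [f] along the positively oriented boundary
   of [[a, b] x [c, d]]; opposite sides are paired so that the affine part of
   [f] contributes constant integrands. *)
Definition boundary_Re f a b c d : R :=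
  \int[mu]_(x in `[a, b])
     (complex.Re (f (x +i* c)) - complex.Re (f (x +i* d))) -
  \int[mu]_(y in `[c, d])
     (complex.Im (f (b +i* y)) - complex.Im (f (a +i* y))).

Definition rect_cdiff f a b c d :=
  forall x y, a <= x <= b -> c <= y <= d -> cdiff f (x +i* y).

Lemma rect_cdiff_sub f a b c d a' b' c' d' : a <= a' -> b' <= b ->
  c <= c' -> d' <= d -> rect_cdiff f a b c d -> rect_cdiff f a' b' c' d'.
Proof. by move=> ? ? ? ? fd x y xab ycd; apply: fd; lra. Qed.

Lemma rect_Re_continuous f a b c d y : rect_cdiff f a b c d -> c <= y <= d ->
  seg_continuous (fun x => complex.Re (f (x +i* y))) a b.
Proof. by move=> fd yd x xab; exact/cdiff_Re_horizontal/fd. Qed.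

Lemma rect_Im_continuous f a b c d x : rect_cdiff f a b c d -> a <= x <= b ->
  seg_continuous (fun y => complex.Im (f (x +i* y))) c d.
Proof. by move=> fd xd y yab; exact/cdiff_Im_vertical/fd. Qed.

Lemma boundary_Re_vsplit f a m b c d : a <= m <= b -> c <= d ->
  rect_cdiff f a b c d ->
  boundary_Re f a b c d = boundary_Re f a m c d + boundary_Re f m b c d.
Proof.
move=> /andP[am mb] cd fd; rewrite /boundary_Re.
have cF := rect_Im_continuous fd.
rewrite (@Rintegral_split _ _ a m b)//; last first.
  by apply: seg_continuousB; apply: (rect_Re_continuous fd); lra.
rewrite !RintegralB//; try (by apply: seg_integrable; apply: cF; lra);
  try (apply: (@seg_integrable _ (fun x => complex.Re _));
    apply: seg_continuous_sub (rect_Re_continuous fd _) => //; lra).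
ring.
Qed.

Lemma boundary_Re_hsplit f a b c m d : a <= b -> c <= m <= d ->
  rect_cdiff f a b c d ->
  boundary_Re f a b c d = boundary_Re f a b c m + boundary_Re f a b m d.
Proof.
move=> ab /andP[cm md] fd; rewrite /boundary_Re.
have cF := rect_Re_continuous fd.
rewrite (@Rintegral_split _ (fun y => complex.Im _ - _) c m d)//; last first.
  by apply: seg_continuousB; apply: (rect_Im_continuous fd); lra.
rewrite !RintegralB//; try (by apply: seg_integrable; apply: cF; lra);
  try (apply: (@seg_integrable _ (fun x => complex.Im _));
    apply: seg_continuous_sub (rect_Im_continuous fd _) => //; lra).
ring.
Qed.

(** The affine part of [f] cancels: if [k2] is the imaginary part of its slope, both paired
    integrals equal [k2 * (b - a) * (d - c)]. What remains is an error [e * l] from each of two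
    opposite sides. *)
Lemma boundary_Re_small f a b c d (x0 y0 e l : R) : a <= b -> c <= d ->
  0 <= e -> rect_cdiff f a b c d ->
  b - a + (d - c) <= l ->
  a <= x0 <= b -> c <= y0 <= d ->
  (exists k, forall w, cabs w <= l ->
     cabs (f (x0 +i* y0 + w) - f (x0 +i* y0) - k * w) <= e * cabs w) ->
  `|boundary_Re f a b c d| <= 2 * e * l * (b - a + (d - c)).
Proof.
move=> ab cd e0 fd abl x0ab y0cd [[k1 k2] fk].
have near x y : a <= x <= b -> c <= y <= d ->
    cabs (f (x +i* y) - f (x0 +i* y0) -
      (k1 +i* k2) * ((x - x0) +i* (y - y0))) <= e * l.
  move=> xab ycd.
  have wl : cabs ((x - x0) +i* (y - y0)) <= l.
    apply: (le_trans (cabs_le_ReIm _)) => /=.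
    have : `|x - x0| <= b - a by rewrite ler_norml; lra.
    have : `|y - y0| <= d - c by rewrite ler_norml; lra.
    by lra.
  have := fk _ wl.
  rewrite [in X in f X - _](_ : _ + _ = x +i* y); last first.
    by congr Complex => /=; ring.
  by move=> /le_trans; apply; rewrite ler_wpM2l.
have Re_near x : a <= x <= b ->
    `|(complex.Re (f (x +i* c)) - complex.Re (f (x +i* d))) - k2 * (d - c)|
      <= 2 * e * l.
  move=> xab.
  have h1 := le_trans (ler_Re_cabs _) (near x c xab ltac:(lra)).
  have h2 := le_trans (ler_Re_cabs _) (near x d xab ltac:(lra)).
  move: h1 h2; rewrite !ReB/= !ler_norml; lra.
have Im_near y : c <= y <= d ->
    `|(complex.Im (f (b +i* y)) - complex.Im (f (a +i* y))) - k2 * (b - a)|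
      <= 2 * e * l.
  move=> ycd.
  have h1 := le_trans (ler_Im_cabs _) (near a y ltac:(lra) ycd).
  have h2 := le_trans (ler_Im_cabs _) (near b y ltac:(lra) ycd).
  move: h1 h2; rewrite !ImB/= !ler_norml; lra.
have := Rintegral_near_cst ab
  (seg_continuousB (rect_Re_continuous fd (y := c) ltac:(lra))
                   (rect_Re_continuous fd (y := d) ltac:(lra))) Re_near.
have := Rintegral_near_cst cd
  (seg_continuousB (rect_Im_continuous fd (x := b) ltac:(lra))
                   (rect_Im_continuous fd (x := a) ltac:(lra))) Im_near.
rewrite /boundary_Re !ler_norml; lra.
Qed.

End goursat.

Section goursat_theorem.
Context {R : realType}.
Variables (f : R[i] -> R[i]) (a0 b0 c0 d0 : R).
Hypotheses (ab0 : a0 <= b0) (cd0 : c0 <= d0) (fd : rect_cdiff f a0 b0 c0 d0).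

Definition side_sum (q : R * R * (R * R)) := q.1.2 - q.1.1 + (q.2.2 - q.2.1).

(** The boundary integral is measured against the square of the side sum rather than the area, since
    degenerate rectangles are allowed. *)
Let bad (e : R) (q : R * R * (R * R)) :=
  [/\ a0 <= q.1.1, q.1.1 <= q.1.2, q.1.2 <= b0,
      [/\ c0 <= q.2.1, q.2.1 <= q.2.2 & q.2.2 <= d0] &
      e * side_sum q ^+ 2 < `|boundary_Re f q.1.1 q.1.2 q.2.1 q.2.2|].

Let half (q q' : R * R * (R * R)) :=
  [/\ q.1.1 <= q'.1.1, q'.1.2 <= q.1.2, q.2.1 <= q'.2.1, q'.2.2 <= q.2.2 &
      side_sum q' = side_sum q / 2].

(* Each bad rectangle has a bad quarter: [boundary_Re] is additive and the
   square of the side sum is divided by 4. *)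
Let bisect e q : bad e q -> exists q', bad e q' /\ half q q'.
Proof.
case: q => [[a b] [c d]] [/= aa ab bb [cc cd dd]]; rewrite /side_sum/= => eq.
have fdq : rect_cdiff f a b c d by apply: rect_cdiff_sub fd.
pose m := (a + b) / 2; pose n := (c + d) / 2.
have [am mb] : a <= m /\ m <= b by split; rewrite /m; lra.
have [cn nd] : c <= n /\ n <= d by split; rewrite /n; lra.
have am_eq : m - a = (b - a) / 2 by rewrite /m; field.
have mb_eq : b - m = (b - a) / 2 by rewrite /m; field.
have cn_eq : n - c = (d - c) / 2 by rewrite /n; field.
have nd_eq : d - n = (d - c) / 2 by rewrite /n; field.
have fal : rect_cdiff f a m c d by apply: rect_cdiff_sub fdq.
have far : rect_cdiff f m b c d by apply: rect_cdiff_sub fdq.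
have E : boundary_Re f a b c d =
   (boundary_Re f a m c n + boundary_Re f a m n d) +
   (boundary_Re f m b c n + boundary_Re f m b n d).
  rewrite (boundary_Re_vsplit _ cd fdq (m := m)) ?am//.
  by rewrite (boundary_Re_hsplit _ _ fal (m := n)) ?cn//
    (boundary_Re_hsplit _ _ far (m := n)) ?cn.
apply: contrapT => no.
have sub a' b' c' d' : a <= a' -> a' <= b' -> b' <= b -> c <= c' -> c' <= d' ->
    d' <= d -> b' - a' = (b - a) / 2 -> d' - c' = (d - c) / 2 ->
    `|boundary_Re f a' b' c' d'| <= e * (b - a + (d - c)) ^+ 2 / 4.
  move=> h1 h2 h3 h4 h5 h6 h7 h8; rewrite leNgt; apply/negP => h9.
  apply: no; exists ((a', b'), (c', d')); split; last first.
    by split => //=; rewrite /side_sum/= h7 h8 -mulrDl.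
  split => /=; [exact: le_trans h1|by []|exact: le_trans bb|split|] => //=.
  - exact: le_trans h4.
  - exact: le_trans dd.
  rewrite /side_sum/= h7 h8 -mulrDl exprMn mulrA.
  by rewrite (_ : 2^-1 ^+ 2 = 4^-1)//; field.
move: eq; rewrite E ltNge => /negP; apply.
apply: le_trans (ler_normD _ _) _.
apply: le_trans (lerD (ler_normD _ _) (ler_normD _ _)) _.
have h1 := sub a m c n (lexx _) am mb (lexx _) cn nd am_eq cn_eq.
have h2 := sub a m n d (lexx _) am mb cn nd (lexx _) am_eq nd_eq.
have h3 := sub m b c n am mb (lexx _) (lexx _) cn nd mb_eq cn_eq.
have h4 := sub m b n d am mb (lexx _) cn nd (lexx _) mb_eq nd_eq.
apply: le_trans (lerD (lerD h1 h2) (lerD h3 h4)) _.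
by rewrite le_eqVlt; apply/orP; left; apply/eqP; field.
Qed.

Let nested_point (u v : nat -> R) : nondecreasing_seq u ->
  nonincreasing_seq v -> (forall n, u n <= v n) ->
  exists x, forall n, u n <= x <= v n.
Proof.
move=> iu dv uv; exists (sup (range u)) => n.
have uvn m : u m <= v n.
  case: (leP m n) => mn; first exact: le_trans (iu _ _ mn) (uv _).
  by apply: le_trans (uv _) _; apply: dv; apply: ltnW.
apply/andP; split.
  by apply: ub_le_sup; [exists (v n) => _ [m _ <-]|exists n].
by apply: ge_sup; [exists (u 0%N), 0%N|move=> _ [m _ <-]].
Qed.

Theorem goursat : boundary_Re f a0 b0 c0 d0 = 0.
Proof.
apply/eqP; apply/negPn/negP => B0.
pose L := b0 - a0 + (d0 - c0).
have L0 : 0 <= L by rewrite addr_ge0 ?subr_ge0.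
have L1 : 0 < L + 1 by rewrite ltr_wpDl.
(* With [L + 1] in place of [L] the initial rectangle is strictly bad, and [L = 0] causes no
   division by zero. *)
pose e := `|boundary_Re f a0 b0 c0 d0| / (L + 1) ^+ 2.
have e0 : 0 < e by rewrite divr_gt0 ?normr_gt0// exprn_gt0.
have [step stepP] : exists step, forall q, bad e q -> bad e (step q) /\ half q (step q).
  have : forall q, exists q', bad e q -> bad e q' /\ half q q'.
    move=> q; have [/bisect[q' ?]|nq] := pselect (bad e q); first by exists q'.
    by exists q.
  by move=> /choice[st ?]; exists st.
pose Q n := iter n step ((a0, b0), (c0, d0)).
have badQ n : bad e (Q n).
  elim: n => [|n IH]; last by have [] := stepP _ IH.
  split => //=; rewrite /side_sum/= -/L /e mulrAC ltr_pdivrMr ?exprn_gt0//.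
  by rewrite ltr_pM2l ?normr_gt0// ltr_pXn2r// ?nnegrE ?ltrDl// ltW.
have halfQ n : half (Q n) (Q n.+1) by have [] := stepP _ (badQ n).
have sideQ n : side_sum (Q n) = L / 2 ^+ n.
  elim: n => [|n IH]; first by rewrite divr1.
  by have [_ _ _ _ ->] := halfQ n; rewrite IH exprS invfM; lra.
have [x xQ] : exists x, forall n, (Q n).1.1 <= x <= (Q n).1.2.
  apply: nested_point.
  - by apply/nondecreasing_seqP => n; case: (halfQ n).
  - by apply/nonincreasing_seqP => n; case: (halfQ n).
  - by move=> n; case: (badQ n).
have [y yQ] : exists y, forall n, (Q n).2.1 <= y <= (Q n).2.2.
  apply: nested_point.
  - by apply/nondecreasing_seqP => n; case: (halfQ n).
  - by apply/nonincreasing_seqP => n; case: (halfQ n).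
  - by move=> n; case: (badQ n) => _ _ _ [].
have [k fk] := fd (xQ 0%N) (yQ 0%N).
(* [boundary_Re_small] with [e / 4] gives [e / 2] times the squared side sum, which contradicts
   badness. *)
have e4 : 0 < e / 4 by rewrite divr_gt0.
have [dl dl0 fdl] := fk _ e4.
have [n Ln] : exists n, L / 2 ^+ n < dl.
  exists (Num.truncn (L / dl)).+1.
  rewrite ltr_pdivrMr ?exprn_gt0// mulrC -ltr_pdivrMr//.
  apply: (lt_le_trans (truncnS_gt _)).
  rewrite -natrX ler_nat; apply/ltnW/ltn_expl; exact: ltnSn.
have [aa ab bb [cc cd dd]] := badQ n; rewrite ltNge => /negP; apply.
apply: (@le_trans _ _ (2 * (e / 4) * side_sum (Q n) * side_sum (Q n))); last first.
  have := mulr_ge0 (ltW e0) (sqr_ge0 (side_sum (Q n))).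
  rewrite expr2; lra.
apply: (boundary_Re_small (x0 := x) (y0 := y)) => //; first exact: ltW.
  exact: rect_cdiff_sub fd.
exists k => w wn; apply: fdl; apply: le_lt_trans wn _.
by rewrite sideQ.
Qed.

End goursat_theorem.

(** * Measurability in the plane and changes of variable on the line *)

Section plane_measurability.
Context {R : realType}.
Local Notation mu := (@lebesgue_measure R).

(** The integral is a supremum over the nonnegative simple functions below the integrand, and
    enlarging the integrand enlarges this family. *)
Lemma le_integral_nonneg d (T : measurableType d) (nu : {measure set T -> \bar R})
    (D : set T) (g h : T -> \bar R) :
  (forall x, D x -> 0 <= g x)%E -> (forall x, D x -> g x <= h x)%E ->
  (\int[nu]_(x in D) g x <= \int[nu]_(x in D) h x)%E.
Proof.
move=> g0 gh; rewrite !ge0_integralE//; last first.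
  by move=> x Dx; apply: le_trans (gh _ Dx); exact: g0.
apply: ereal_sup_le => _ [k /= kg <-]; exists k => //= x.
apply: le_trans (kg x) _; rewrite /patch; case: ifPn => // xD.
by apply: gh; rewrite inE in xD.
Qed.

(** Links the product topology with the product sigma-algebra: [A] is the countable union of the
    boxes inside it with rational centre and radius [1 / (n + 1)]; boxes not inside [A] are replaced
    by the empty set. *)
Lemma open_plane_measurable (A : set (R * R)) : open A -> measurable A.
Proof.
move=> oA.
pose rad (n : nat) : R := n.+1%:R^-1.
pose box (k : rat * rat * nat) : set (R * R) :=
  ball (ratr k.1.1 : R) (rad k.2) `*` ball (ratr k.1.2 : R) (rad k.2).
pose F k := if pselect (box k `<=` A) then box k else set0.
have -> : A = \bigcup_k F k.
  apply/seteqP; split => [[x y] Axy|[x y] [k _]]; last first.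
    by rewrite /F; case: pselect => // /[apply].
  have nA : nbhs (x, y) A by apply: open_nbhs_nbhs.
  move: nA => /nbhs_ballP[/= e e0 eA].
  have [n ne] : exists n, rad n < e / 2.
    exists (Num.truncn (e / 2)^-1).
    rewrite /rad invf_plt ?posrE ?divr_gt0//; exact: truncnS_gt.
  have n0 : 0 < rad n by rewrite invr_gt0.
  have [|p] := @rat_in_itvoo _ x (x + rad n); first by rewrite ltrDl.
  rewrite in_itv/= => /andP[xp px].
  have [|q] := @rat_in_itvoo _ y (y + rad n); first by rewrite ltrDl.
  rewrite in_itv/= => /andP[yq qy].
  have boxA : box (p, q, n) `<=` A.
    move=> [u v] [/= up vq]; apply: eA; split.
      by move: up; rewrite /ball/= !ltr_norml => /andP[? ?]; apply/andP; split; lra.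
    by move: vq; rewrite /ball/= !ltr_norml => /andP[? ?]; apply/andP; split; lra.
  exists (p, q, n) => //; rewrite /F.
  case: (pselect (box (p, q, n) `<=` A)) => //= pqnA.
  by split; rewrite /ball/= ltr_norml; apply/andP; split; lra.
apply: countable_bigcupT_measurable; first exact: countableP.
move=> k; rewrite /F; case: pselect => [kA|kA] /=; last exact: measurable0.
by apply: measurableX; exact: measurable_ball.
Qed.

Lemma continuous_plane_measurable (g : R * R -> R) :
  continuous g -> measurable_fun setT g.
Proof.
move=> /continuousP cg; apply: (measurability _ (RGenOpens.measurableE R)).
move=> _ [_ [a [b ->] <-]]; rewrite setTI; apply: open_plane_measurable.
exact/cg/interval_open.
Qed.

Lemma ge0_integral_translation (c : R) (g : R -> \bar R) :
  measurable_fun setT g -> (forall x, 0 <= g x)%E ->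
  (\int[mu]_x g (c + x)%R = \int[mu]_x g x)%E.
Proof.
move=> mg g0.
pose phi : measurableTypeR R -> measurableTypeR R := +%R c.
have mphi : measurable_fun setT phi by apply: measurable_funD.
rewrite -[LHS](@ge0_integral_pushforward _ _ _ _ _ phi mphi mu setT g)//.
apply: eq_measure_integral => //= A mA _; apply/esym.
apply: lebesgue_measure_unique => //= _ [[a b]] _ <-.
rewrite /pushforward (_ : phi @^-1` _ = `](a - c), (b - c)]%classic).
  rewrite !lebesgue_measure_itv/= !lte_fin ltrD2r.
  by case: ifP => // _; rewrite -!EFinB; congr EFin; ring.
by apply/seteqP; split => x /=; rewrite !in_itv/= /phi => /andP[? ?];
  apply/andP; split; lra.
Qed.

Lemma ge0_integral_reflection (g : R -> \bar R) :
  measurable_fun setT g -> (forall x, 0 <= g x)%E ->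
  (\int[mu]_x g (- x)%R = \int[mu]_x g x)%E.
Proof.
move=> mg g0.
pose phi : measurableTypeR R -> measurableTypeR R := -%R.
have mphi : measurable_fun setT phi by apply: oppr_measurable.
rewrite -[LHS](@ge0_integral_pushforward _ _ _ _ _ phi mphi mu setT g)//.
by apply: eq_measure_integral => //= A mA _; exact: lebesgue_measureN.
Qed.

End plane_measurability.

Section integral_change.
Context {R : realType}.
Local Notation mu := (@lebesgue_measure R).

Lemma le_integral_translation (c : R) (A B : set R) (g : R -> \bar R) :
  measurable B -> measurable_fun setT g -> (forall x, 0 <= g x)%E ->
  (forall x, A x -> B (c + x)) ->
  (\int[mu]_(x in A) g (c + x)%R <= \int[mu]_(x in B) g x)%E.
Proof.
move=> mB mg g0 AB; rewrite [leLHS]integral_mkcond [leRHS]integral_mkcond.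
rewrite -(ge0_integral_translation c (g := g \_ B)); last 2 first.
- by apply/(measurable_restrictT _ _).1 => //; exact: measurable_funTS.
- by move=> x; apply: erestrict_ge0.
apply: le_integral_nonneg => x _; first by apply: erestrict_ge0.
rewrite /patch; case: ifPn => [xA|_]; last by case: ifPn.
by rewrite ifT// inE; apply: AB; rewrite inE in xA.
Qed.

Lemma le_integral_reflection (c : R) (A B : set R) (g : R -> \bar R) :
  measurable B -> measurable_fun setT g -> (forall x, 0 <= g x)%E ->
  (forall x, A x -> B (c - x)) ->
  (\int[mu]_(x in A) g (c - x)%R <= \int[mu]_(x in B) g x)%E.
Proof.
move=> mB mg g0 AB; rewrite [leLHS]integral_mkcond [leRHS]integral_mkcond.
have mgB : measurable_fun setT (g \_ B).
  by apply/(measurable_restrictT _ _).1 => //; exact: measurable_funTS.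
have gB0 x : (0 <= (g \_ B) x)%E by apply: erestrict_ge0.
have mgc : measurable_fun setT (fun x => (g \_ B) (c + x)).
  by apply: measurableT_comp => //; exact: measurable_funD.
rewrite -[leRHS](ge0_integral_translation c)//.
rewrite -[leRHS](ge0_integral_reflection mgc (fun x => gB0 _)).
apply: le_integral_nonneg => x _; first by apply: erestrict_ge0.
rewrite /patch; case: ifPn => [xA|_]; last by case: ifPn.
by rewrite ifT// inE; apply: AB; rewrite inE in xA.
Qed.

End integral_change.

Ltac complex_ring :=
  apply/eqP; rewrite eq_complex /=; apply/andP; split; apply/eqP => /=; ring.

(** * The reflection inequality *)

Section reflection_inequality.
Context {R : realType}.
Implicit Types (F : R[i] -> R[i]) (W : R -> R -> R) (a s c d : R).
Local Notation mu := (@lebesgue_measure R).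

Definition plane_continuous W := continuous (fun p : R * R => W p.1 p.2).

Lemma plane_continuousl W y : plane_continuous W -> continuous (W ^~ y).
Proof.
move=> cW x.
apply: (cvg_comp (fun t => (t, y)) (fun p => W p.1 p.2) _ (cW (x, y))).
by apply: (cvg_pair (G := nbhs x) (H := nbhs y)); [exact: cvg_id|exact: cvg_cst].
Qed.

Lemma plane_continuousr W x : plane_continuous W -> continuous (W x).
Proof.
move=> cW y.
apply: (cvg_comp (fun t => (x, t)) (fun p => W p.1 p.2) _ (cW (x, y))).
by apply: (cvg_pair (G := nbhs x) (H := nbhs y)); [exact: cvg_cst|exact: cvg_id].
Qed.

Lemma EFin_seg_Rintegral (g : R -> R) a b : seg_continuous g a b ->
  (\int[mu]_(x in `[a, b]) g x)%R%:E = (\int[mu]_(x in `[a, b]) (g x)%:E)%E.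
Proof.
move=> cg; rewrite /Rintegral fineK//; apply: integrable_fin_num => //.
exact: seg_integrable.
Qed.

Lemma cabs_mul_le (z w : R[i]) : cabs z * cabs w <= 2^-1 * (cabs z ^+ 2 + cabs w ^+ 2).
Proof. by have := sqr_ge0 (cabs z - cabs w); lra. Qed.

Lemma Re_mulNi (z : R[i]) : complex.Re (- 'i * z) = complex.Im z.
Proof. by case: z => u v /=; ring. Qed.

Lemma Im_mulNi (z : R[i]) : complex.Im (- 'i * z) = - complex.Re z.
Proof. by case: z => u v /=; ring. Qed.

(* Goursat for [F z * conjc (F z')], [z'] the mirror image of [z] in the line
   [Re z = a]; on that line the product is [|F|^2]. *)
Lemma reflection_identity F a s c d : 0 <= s -> c <= d ->
  rect_cdiff F (a - s) (a + s) c d ->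
  let H x y := F (x +i* y) * conjc (F ((2 * a - x) +i* y)) in
  [/\ seg_continuous (fun y => complex.Re (H (a + s) y)) c d,
      seg_continuous (fun x => complex.Im (H x c) - complex.Im (H x d)) a (a + s) &
  \int[mu]_(y in `[c, d]) (cabs (F (a +i* y)) ^+ 2) =
  \int[mu]_(y in `[c, d]) (complex.Re (H (a + s) y)) +
  \int[mu]_(x in `[a, a + s]) (complex.Im (H x c) - complex.Im (H x d))].
Proof.
move=> s0 cd Fd H.
(* [boundary_Re] sees only real parts on horizontal sides and imaginary parts on vertical ones; the
   factor [- 'i] exchanges the two, so that the vertical side on the axis carries [|F|^2]. Goursat
   is applied on the right half [[a, a + s]] of the rectangle. *)
pose K z := - 'i * (F z * conjc (F (conjc (-1 * z + (2 * a)%:C)))).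
have mirror x y : conjc (-1 * (x +i* y) + (2 * a)%:C) = (2 * a - x) +i* y.
  by complex_ring.
have ReK x y : complex.Re (K (x +i* y)) = complex.Im (H x y).
  rewrite /K /H mirror.
  exact: Re_mulNi.
have ImK x y : complex.Im (K (x +i* y)) = - complex.Re (H x y).
  rewrite /K /H mirror.
  exact: Im_mulNi.
have Kd : rect_cdiff K a (a + s) c d.
  move=> x y xas ycd; apply: cdiff_mul_i; apply: cdiffM; first by apply: Fd; lra.
  apply: (@cdiff_affine _ (fun w => conjc (F (conjc w)))); apply: cdiff_conj.
  by rewrite mirror; apply: Fd; lra.
have cRe : seg_continuous (fun y => complex.Re (H (a + s) y)) c d.
  move=> y ycd.
  rewrite (_ : (fun _ => _) = fun y => - complex.Im (K ((a + s) +i* y))).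
    by apply: cvgN; apply: (rect_Im_continuous Kd); lra.
  by apply/funext => t; rewrite ImK opprK.
have cIm : seg_continuous (fun x => complex.Im (H x c) - complex.Im (H x d))
    a (a + s).
  move=> x xas.
  rewrite (_ : (fun _ => _) =
      fun x => complex.Re (K (x +i* c)) - complex.Re (K (x +i* d))).
    by apply: cvgB; apply: (rect_Re_continuous Kd) => //; lra.
  by apply/funext => t; rewrite !ReK.
split => //; have := goursat _ cd Kd; rewrite /boundary_Re => /(_ ltac:(lra))/eqP.
under eq_Rintegral do rewrite !ReK.
rewrite subr_eq0 => /eqP ->.
rewrite -RintegralD//.
- by apply: eq_Rintegral => y _; rewrite !ImK /H (_ : 2 * a - a = a); [|ring];
  rewrite sqr_cabs; case: (F (a +i* y)) => u v /=; ring.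
- exact: (seg_integrable cRe).
- apply: (seg_integrable (g := fun y => complex.Im _ - complex.Im _)).
  by apply: seg_continuousB; apply: (rect_Im_continuous Kd); lra.
Qed.

(** [W] extends [|F|^2] continuously from the rectangle to the plane: [F] may have poles elsewhere,
    while measurability and changes of variable are handled on whole lines. The products
    [|F(z)| |F(z')|] are split by the arithmetic-geometric mean inequality. *)
Lemma reflection_inequality F W a s c d : 0 <= s -> c <= d ->
  rect_cdiff F (a - s) (a + s) c d -> plane_continuous W ->
  (forall x y, 0 <= W x y) ->
  (forall x y, a - s <= x <= a + s -> c <= y <= d ->
     W x y = cabs (F (x +i* y)) ^+ 2) ->
  (\int[mu]_(y in `[c, d]) (W a y)%:E <=
   \int[mu]_(y in `[c, d]) (W (a + s) y + W (a - s) y)%:E +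
   \int[mu]_(x in `[(a - s)%R, (a + s)%R]) (W x c + W x d)%:E)%E.
Proof.
move=> s0 cd Fd cW W0 WF; have [cRe cIm eqF] := reflection_identity s0 cd Fd.
have cWl y : continuous (W ^~ y) by exact: plane_continuousl.
have cWr x : continuous (W x) by exact: plane_continuousr.
pose V x := W x c + W x d.
have cV : continuous V by move=> x; apply: cvgD; exact: cWl.
have cVr : continuous (fun x => V (2 * a - x)).
  move=> x; apply: (cvg_comp (fun t => 2 * a - t) V _ (cV _)).
  by apply: cvgB; [exact: cvg_cst|exact: cvg_id].
have V0 x : 0 <= V x by rewrite addr_ge0.
have le1 : \int[mu]_(y in `[c, d]) W a y <=
    \int[mu]_(y in `[c, d]) (W (a + s) y + W (a - s) y) +
    \int[mu]_(x in `[a, a + s]) (2^-1 * (V x + V (2 * a - x))).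
  have -> : \int[mu]_(y in `[c, d]) W a y =
      \int[mu]_(y in `[c, d]) (cabs (F (a +i* y)) ^+ 2).
    apply: eq_Rintegral => y; rewrite inE/= in_itv/= => ycd.
    by rewrite WF//; lra.
  rewrite eqF; apply: lerD; apply: le_Rintegral => //.
  - exact: seg_integrable cRe.
  - by apply: seg_integrable => y _; apply: cvgD; exact: cWr.
  - move=> y /=; rewrite in_itv/= => ycd.
    apply: le_trans (le_trans (ler_norm _) (ler_Re_cabs _)) _.
    rewrite cabsM cabsJ (_ : 2 * a - (a + s) = a - s); last by ring.
    apply: le_trans (cabs_mul_le _ _) _.
    have := W0 (a + s) y; have := W0 (a - s) y.
    by rewrite !WF; lra.
  - exact: seg_integrable cIm.
  - apply: seg_integrable => y _; apply: cvgM; first exact: cvg_cst.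
    by apply: cvgD; [exact: cV|exact: cVr].
  - move=> x /=; rewrite in_itv/= => xas.
    apply: le_trans (ler_norm _) _; apply: le_trans (ler_normB _ _) _.
    apply: le_trans (lerD (ler_Im_cabs _) (ler_Im_cabs _)) _.
    rewrite !cabsM !cabsJ.
    apply: le_trans (lerD (cabs_mul_le _ _) (cabs_mul_le _ _)) _.
    by rewrite /V !WF; lra.
rewrite -(lee_fin) EFinD in le1.
rewrite !EFin_seg_Rintegral in le1; last 3 first.
- by move=> x _; apply: cvgM; [exact: cvg_cst|apply: cvgD; [exact: cV|exact: cVr]].
- by move=> y _; apply: cvgD; exact: cWr.
- by move=> y _; exact: cWr.
apply: le_trans le1 _; apply: leeD => //.
have mV : measurable_fun setT (fun x : R => (2^-1 * V x)%:E).
  apply/measurable_EFinP; apply: measurable_funM => //.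
  exact: continuous_measurable_fun.
have mVr : measurable_fun setT (fun x : R => (2^-1 * V (2 * a - x))%:E).
  apply/measurable_EFinP; apply: measurable_funM => //.
  exact: continuous_measurable_fun.
have V20 x : (0 <= (2^-1 * V x)%:E)%E by rewrite lee_fin mulr_ge0.
under eq_integral do rewrite mulrDr EFinD.
rewrite ge0_integralD//; try exact: measurable_funTS.
(* Both the half-segment and its mirror image are enlarged to the full segment, which uses up the
   factor [2^-1]. *)
apply: (@le_trans _ _ (\int[mu]_(x in `[(a - s)%R, (a + s)%R]) (2^-1 * V x)%:E +
   \int[mu]_(x in `[(a - s)%R, (a + s)%R]) (2^-1 * V x)%:E)%E).
  apply: leeD.
    apply: ge0_subset_integral => //; first exact: measurable_funTS.
    by move=> x /=; rewrite !in_itv/=; lra.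
  apply: (le_integral_reflection (g := fun x => (2^-1 * V x)%:E)) => // x /=.
  by rewrite !in_itv/=; lra.
rewrite -ge0_integralD//; try exact: measurable_funTS.
apply: le_integral_nonneg => x _; first by rewrite adde_ge0.
by rewrite -EFinD lee_fin /V; lra.
Qed.

End reflection_inequality.

(** * Iterated integrals over rectangles *)

Section rectangle_integrals.
Context {R : realType}.
Local Notation mu := (@lebesgue_measure R).
Local Notation mu2 := (mu \x mu)%E.
Implicit Types (g : R * R -> \bar R) (A B : set R).

Lemma measurable_section_integral g B : measurable B -> measurable_fun setT g ->
  (forall p, 0 <= g p)%E ->
  measurable_fun setT (fun x => \int[mu]_(y in B) g (x, y))%E.
Proof.
move=> mB mg g0.
have mAB : measurable (setT `*` B : set (R * R)) by exact: measurableX.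
have mgB : measurable_fun setT (g \_ (setT `*` B)).
  by apply/(measurable_restrictT _ _).1 => //; exact: measurable_funTS.
have gB0 p : (0 <= (g \_ (setT `*` B)) p)%E by apply: erestrict_ge0.
have := measurable_fun_fubini_tonelli_F (m2 := mu) _ mgB gB0.
apply: eq_measurable_fun => x _; rewrite /fubini_F [RHS]integral_mkcond.
apply: eq_integral => y _; rewrite /patch in_setX in_setT.
by [].
Qed.

Lemma integral_rect_xy g A B : measurable A -> measurable B ->
  measurable_fun setT g -> (forall p, 0 <= g p)%E ->
  (\int[mu2]_(p in A `*` B) g p = \int[mu]_(x in A) \int[mu]_(y in B) g (x, y))%E.
Proof.
move=> mA mB mg g0.
have mAB : measurable (A `*` B : set (R * R)) by exact: measurableX.
have mgB : measurable_fun setT (g \_ (A `*` B)).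
  by apply/(measurable_restrictT _ _).1 => //; exact: measurable_funTS.
have gB0 p : (0 <= (g \_ (A `*` B)) p)%E by apply: erestrict_ge0.
rewrite [LHS]integral_mkcond [RHS]integral_mkcond.
rewrite (fubini_tonelli1 (m1 := mu) (m2 := mu) _ mgB gB0).
apply: eq_integral => x _; rewrite /fubini_F [in RHS]/patch.
case: ifPn => xA.
  rewrite [RHS]integral_mkcond; apply: eq_integral => y _.
  by rewrite /patch in_setX xA.
rewrite integral0_eq// => y _; rewrite /patch in_setX.
by rewrite (negbTE xA).
Qed.

Lemma integral_rect_yx g A B : measurable A -> measurable B ->
  measurable_fun setT g -> (forall p, 0 <= g p)%E ->
  (\int[mu2]_(p in A `*` B) g p = \int[mu]_(y in B) \int[mu]_(x in A) g (x, y))%E.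
Proof.
move=> mA mB mg g0.
have mAB : measurable (A `*` B : set (R * R)) by exact: measurableX.
have mgB : measurable_fun setT (g \_ (A `*` B)).
  by apply/(measurable_restrictT _ _).1 => //; exact: measurable_funTS.
have gB0 p : (0 <= (g \_ (A `*` B)) p)%E by apply: erestrict_ge0.
rewrite [LHS]integral_mkcond [RHS]integral_mkcond.
rewrite (fubini_tonelli2 (m1 := mu) (m2 := mu) _ mgB gB0).
apply: eq_integral => y _; rewrite /fubini_G [in RHS]/patch.
case: ifPn => yB.
  rewrite [RHS]integral_mkcond; apply: eq_integral => x _.
  by rewrite /patch in_setX yB andbT.
rewrite integral0_eq// => x _; rewrite /patch in_setX.
by rewrite (negbTE yB) andbF.
Qed.

Lemma measurable_swap_comp g : measurable_fun setT g ->
  measurable_fun setT (fun p => g (p.2, p.1)).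
Proof. by move=> mg; apply: measurableT_comp => //; exact: measurable_swap. Qed.

Lemma integral_rect_swap g A B : measurable A -> measurable B ->
  measurable_fun setT g -> (forall p, 0 <= g p)%E ->
  (\int[mu2]_(p in A `*` B) g (p.2, p.1) = \int[mu2]_(p in B `*` A) g p)%E.
Proof.
move=> mA mB mg g0; rewrite (integral_rect_yx mB)// (integral_rect_xy mA)//.
exact: (measurable_swap_comp mg).
Qed.

End rectangle_integrals.

(** * Line integrals bounded by area integrals *)

Section trace_inequality.
Context {R : realType}.
Implicit Types (F : R[i] -> R[i]) (W : R -> R -> R) (a s c d : R).
Local Notation mu := (@lebesgue_measure R).
Local Notation mu2 := (mu \x mu)%E.

Lemma lebesgue_segment a b : a <= b -> mu `[a, b]%classic = (b - a)%:E.
Proof.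
move=> ab; rewrite lebesgue_measure_itv/= lte_fin -EFinB.
by case: ltP => // ba; congr EFin; lra.
Qed.

Lemma lebesgue_segment0 dl : 0 <= dl -> mu `[0, dl]%classic = dl%:E.
Proof. by move=> dl0; rewrite lebesgue_segment// subr0. Qed.

(* [reflection_inequality] on the rectangle enlarged by [s], averaged over
   [s] in [[0, dl]]. *)
Lemma trace_vertical F W a c d dl : c <= d -> 0 <= dl ->
  rect_cdiff F (a - dl) (a + dl) (c - dl) (d + dl) -> plane_continuous W ->
  (forall x y, 0 <= W x y) ->
  (forall x y, a - dl <= x <= a + dl -> c - dl <= y <= d + dl ->
     W x y = cabs (F (x +i* y)) ^+ 2) ->
  (dl%:E * \int[mu]_(y in `[c, d]) (W a y)%:E <=
   4%:E * \int[mu2]_(p in `[(a - dl)%R, (a + dl)%R] `*` `[(c - dl)%R, (d + dl)%R])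
     (W p.1 p.2)%:E)%E.
Proof.
move=> cd dl0 Fd cW W0 WF.
set I := `[(a - dl)%R, (a + dl)%R]%classic.
set J := `[(c - dl)%R, (d + dl)%R]%classic.
have mI : measurable I by exact: measurable_itv.
have mJ : measurable J by exact: measurable_itv.
pose g (p : R * R) := (W p.1 p.2)%:E.
have mg : measurable_fun setT g.
  by apply/measurable_EFinP; exact: continuous_plane_measurable.
have g0 p : (0 <= g p)%E by rewrite lee_fin.
pose P1 x := (\int[mu]_(y in J) g (x, y))%E.
pose P2 y := (\int[mu]_(x in I) g (x, y))%E.
have mP1 : measurable_fun setT P1 by exact: measurable_section_integral.
have mP2 : measurable_fun setT P2.
  apply: (measurable_section_integral (g := fun p => g (p.2, p.1))) => //.
  exact: measurable_swap_comp.
have P10 x : (0 <= P1 x)%E by exact: integral_ge0.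
have P20 x : (0 <= P2 x)%E by exact: integral_ge0.
have mWl y : measurable_fun setT (fun x => (W x y)%:E).
  apply/measurable_EFinP; apply: continuous_measurable_fun.
  exact: plane_continuousl.
have mWr x : measurable_fun setT (fun y => (W x y)%:E).
  apply/measurable_EFinP; apply: continuous_measurable_fun.
  exact: plane_continuousr.
have ptw s : 0 <= s <= dl -> (\int[mu]_(y in `[c, d]) (W a y)%:E <=
    (P1 (a + s)%R + P1 (a - s)%R) + (P2 (c - s)%R + P2 (d + s)%R))%E.
  move=> /andP[s0 sd].
    apply: (@le_trans _ _ (\int[mu]_(y in `[(c - s)%R, (d + s)%R]) (W a y)%:E)%E).
    apply: ge0_subset_integral => //; first exact: measurable_funTS (mWr a).
      by move=> y _; rewrite lee_fin.
    by move=> y /=; rewrite !in_itv/=; lra.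
  apply: le_trans (reflection_inequality (s := s) _ _ _ cW W0 _) _ => //.
  - lra.
  - by apply: rect_cdiff_sub Fd; lra.
  - by move=> x y xs ys; apply: WF; lra.
  under eq_integral do rewrite EFinD.
  under [X in (_ + X)%E]eq_integral do rewrite EFinD.
  rewrite !ge0_integralD//; try (by move=> *; rewrite lee_fin);
    try exact: measurable_funTS (mWr _); try exact: measurable_funTS (mWl _).
  apply: leeD; apply: leeD; apply: ge0_subset_integral => //;
    try (by move=> *; rewrite lee_fin); try exact: measurable_funTS (mWr _);
    try exact: measurable_funTS (mWl _);
    by move=> t; rewrite /I /J /= !in_itv/=; lra.
have -> : (dl%:E * \int[mu]_(y in `[c, d]) (W a y)%:E =
    \int[mu]_(s in `[0%R, dl]) cst (\int[mu]_(y in `[c, d]) (W a y)%:E) s)%E.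
  rewrite integral_cst// muleC; congr (_ * _)%E; exact/esym/lebesgue_segment0.
apply: (@le_trans _ _ (\int[mu]_(s in `[0%R, dl]) ((P1 (a + s)%R + P1 (a - s)%R) +
   (P2 (c - s)%R + P2 (d + s)%R)))%E).
  apply: le_integral_nonneg.
  - by move=> s _; apply: integral_ge0 => y _; rewrite lee_fin.
  - by move=> s /=; rewrite in_itv/=; exact: ptw.
have mD x : measurable_fun setT (fun s : R => x + s) by exact: measurable_funD.
have mB x : measurable_fun setT (fun s : R => x - s) by exact: measurable_funB.
have mP1D : measurable_fun setT (fun s => P1 (a + s)).
  exact: (measurableT_comp mP1 (mD a)).
have mP1B : measurable_fun setT (fun s => P1 (a - s)).
  exact: (measurableT_comp mP1 (mB a)).
have mP2B : measurable_fun setT (fun s => P2 (c - s)).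
  exact: (measurableT_comp mP2 (mB c)).
have mP2D : measurable_fun setT (fun s => P2 (d + s)).
  exact: (measurableT_comp mP2 (mD d)).
rewrite ge0_integralD//; last 4 first.
- by move=> s _; exact: adde_ge0.
- by apply: measurable_funTS; apply: emeasurable_funD.
- by move=> s _; exact: adde_ge0.
- by apply: measurable_funTS; apply: emeasurable_funD.
rewrite [X in (X + _ <= _)%E]ge0_integralD//; try exact: measurable_funTS.
rewrite [X in (_ + X <= _)%E]ge0_integralD//; try exact: measurable_funTS.
(* Each of the four sides moves with [s] and sweeps a part of [I x J], hence the constant 4. The
   area integral may be infinite, so that case is treated apart. *)
have -> : (4%:E * \int[mu2]_(p in I `*` J) (W p.1 p.2)%:E =
  (\int[mu]_(x in I) P1 x + \int[mu]_(x in I) P1 x) +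
  (\int[mu]_(y in J) P2 y + \int[mu]_(y in J) P2 y))%E.
  rewrite -(integral_rect_xy (g := g))// -(integral_rect_yx (g := g))//.
  have : (0 <= \int[mu2]_(p in I `*` J) g p)%E by exact: integral_ge0.
  rewrite -/g; case: (integral _ _ _) => [r| |]//= r0.
    by rewrite -!EFinD -EFinM; congr EFin; ring.
  by rewrite mulry gtr0_sg// mul1e.
apply: leeD; apply: leeD.
- apply: (le_integral_translation (c := a) (g := P1)) => // s.
  by rewrite /I /= !in_itv/=; lra.
- apply: (le_integral_reflection (c := a) (g := P1)) => // s.
  by rewrite /I /= !in_itv/=; lra.
- apply: (le_integral_reflection (c := c) (g := P2)) => // s.
  by rewrite /J /= !in_itv/=; lra.
- apply: (le_integral_translation (c := d) (g := P2)) => // s.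
  by rewrite /J /= !in_itv/=; lra.
Qed.

Lemma trace_horizontal F W a b c dl : a <= b -> 0 <= dl ->
  rect_cdiff F (a - dl) (b + dl) (c - dl) (c + dl) -> plane_continuous W ->
  (forall x y, 0 <= W x y) ->
  (forall x y, a - dl <= x <= b + dl -> c - dl <= y <= c + dl ->
     W x y = cabs (F (x +i* y)) ^+ 2) ->
  (dl%:E * \int[mu]_(x in `[a, b]) (W x c)%:E <=
   4%:E * \int[mu2]_(p in `[(a - dl)%R, (b + dl)%R] `*` `[(c - dl)%R, (c + dl)%R])
     (W p.1 p.2)%:E)%E.
Proof.
move=> ab dl0 Fd cW W0 WF.
pose g (p : R * R) := (W p.1 p.2)%:E.
have mg : measurable_fun setT g.
  by apply/measurable_EFinP; exact: continuous_plane_measurable.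
rewrite -(integral_rect_swap (g := g))//; last by move=> p; rewrite lee_fin.
(* Exchanging the coordinates is a reflection in the diagonal and reverses orientation; the outer
   conjugation restores holomorphy without changing the modulus. *)
pose Ft z := conjc (F (conjc (- 'i * z + 0))).
have FtE x y : Ft (x +i* y) = conjc (F (y +i* x)).
  by rewrite /Ft; congr (conjc (F _)); complex_ring.
apply: (trace_vertical (F := Ft) (W := fun x y => W y x)) => //.
- move=> x y xa yc.
  apply: (@cdiff_affine _ (fun w => conjc (F (conjc w)))); apply: cdiff_conj.
  rewrite (_ : conjc _ = y +i* x); last by complex_ring.
  exact: Fd.
- move=> p; apply: (cvg_comp (fun p => (p.2, p.1)) (fun p => W p.1 p.2) _ (cW (p.2, p.1))).
  by apply: (cvg_pair (G := nbhs p.2) (H := nbhs p.1)); [exact: cvg_snd|exact: cvg_fst].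
- by move=> x y xa yc; rewrite FtE cabsJ WF.
Qed.

End trace_inequality.

(** * The Fejer-Riesz inequality *)

Section fejer_riesz.
Context {R : realType}.
Local Notation mu := (@lebesgue_measure R).
Local Notation mu2 := (mu \x mu)%E.
Variables (F : R[i] -> R[i]) (W : R -> R -> R) (M : R).
Hypotheses (Fd : forall x y, 0 <= y -> cdiff F (x +i* y))
  (cW : plane_continuous W) (W0 : forall x y, 0 <= W x y)
  (WF : forall x y, 0 <= y -> W x y = cabs (F (x +i* y)) ^+ 2)
  (M0 : 0 <= M)
  (WM : forall y, 0 <= y ->
     (\int[mu]_x (W x y)%:E <= (M / (1 + y ^+ 2))%:E)%E).

Let g (p : R * R) := (W p.1 p.2)%:E.

Let mg : measurable_fun setT g.
Proof. by apply/measurable_EFinP; exact: continuous_plane_measurable. Qed.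

Let mWl y : measurable_fun setT (fun x => (W x y)%:E).
Proof.
apply/measurable_EFinP; apply: continuous_measurable_fun.
exact: plane_continuousl.
Qed.

Let mWr x : measurable_fun setT (fun y => (W x y)%:E).
Proof.
apply/measurable_EFinP; apply: continuous_measurable_fun.
exact: plane_continuousr.
Qed.

Let P Y x := (\int[mu]_(y in `[0%R, Y]) g (x, y))%E.

Let mP Y : measurable_fun setT (P Y).
Proof. by apply: measurable_section_integral => // p; rewrite lee_fin. Qed.

Let P0 Y x : (0 <= P Y x)%E.
Proof. by apply: integral_ge0 => y _; rewrite lee_fin. Qed.

Let integral_P Y : 0 <= Y -> (\int[mu]_x P Y x <= (M * Y)%:E)%E.
Proof.
move=> Y0.
have g0 p : (0 <= g p)%E by rewrite lee_fin.
rewrite /P -(integral_rect_xy (A := setT))// (integral_rect_yx (A := setT))//.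
have -> : (M * Y)%:E = (\int[mu]_(y in `[0%R, Y]) cst M%:E y)%E.
  by rewrite integral_cst// EFinM; congr (_ * _)%E; exact/esym/lebesgue_segment0.
apply: le_integral_nonneg => y; first by move=> _; exact: integral_ge0.
rewrite /= in_itv/= => /andP[y0 _]; apply: le_trans (WM y0) _.
rewrite lee_fin ler_pdivrMr ?ltr_wpDr ?sqr_ge0//.
by rewrite ler_peMr// lerDl sqr_ge0.
Qed.

(** In the rectangle [[a - s, a + s] x [0, Y]] the horizontal sides are enlarged to whole lines, so
    that only the lateral ones depend on [s]. Averaged over [s], each of these costs at most the
    integral over the strip of height [Y], that is [M * Y]. *)
Let averaged a Y S : 0 <= Y -> 0 <= S ->
  (S%:E * P Y a <= (2 * (M * Y))%:E +
     S%:E * (\int[mu]_x (W x 0)%:E + \int[mu]_x (W x Y)%:E))%E.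
Proof.
move=> Y0 S0; set B := (\int[mu]_x (W x 0)%:E + _)%E.
have B0 : (0 <= B)%E.
  by apply: adde_ge0; apply: integral_ge0 => x _; rewrite lee_fin.
have ptw s : 0 <= s -> (P Y a <= (P Y (a + s)%R + P Y (a - s)%R) + B)%E.
  move=> s0.
  apply: le_trans (reflection_inequality (F := F) (s := s) _ _ _ cW W0 _) _ => //.
  - by move=> x y _ /andP[y0 _]; exact: Fd.
  - by move=> x y _ /andP[y0 _]; exact: WF.
  under eq_integral do rewrite EFinD.
  under [X in (_ + X)%E]eq_integral do rewrite EFinD.
  rewrite [X in (X + _ <= _)%E]ge0_integralD//;
    try (by move=> *; rewrite lee_fin); try exact: measurable_funTS (mWr _).
  apply: leeD => //.
  rewrite ge0_integralD//;
    try (by move=> *; rewrite lee_fin); try exact: measurable_funTS (mWl _).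
  by apply: leeD; apply: ge0_subset_integral => //; try exact: mWl;
    move=> x _; rewrite lee_fin.
have -> : (S%:E * P Y a = \int[mu]_(s in `[0%R, S]) cst (P Y a) s)%E.
  by rewrite integral_cst// muleC; congr (_ * _)%E; exact/esym/lebesgue_segment0.
apply: (@le_trans _ _ (\int[mu]_(s in `[0%R, S])
    ((P Y (a + s)%R + P Y (a - s)%R) + cst B s))%E).
  apply: le_integral_nonneg => s; first by move=> _; exact: P0.
  by rewrite /= in_itv/= => /andP[s0 _]; exact: ptw.
have mPD : measurable_fun setT (fun s : R => P Y (a + s)).
  by apply: (measurableT_comp (mP Y)); exact: measurable_funD.
have mPB : measurable_fun setT (fun s : R => P Y (a - s)).
  by apply: (measurableT_comp (mP Y)); exact: measurable_funB.
rewrite ge0_integralD//; last 2 first.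
- by move=> s _; exact: adde_ge0.
- by apply: measurable_funTS; exact: emeasurable_funD.
apply: leeD; last first.
  rewrite integral_cst// muleC le_eqVlt; apply/orP; left; apply/eqP.
  by congr (_ * _)%E; exact/lebesgue_segment0.
rewrite ge0_integralD//; try exact: measurable_funTS.
rewrite mulr2n mulrDl mul1r EFinD; apply: leeD.
- apply: le_trans (integral_P Y0).
  exact: (le_integral_translation (c := a) (g := P Y)).
- apply: le_trans (integral_P Y0).
  exact: (le_integral_reflection (c := a) (g := P Y)).
Qed.

(* In [averaged], the lateral sides contribute [2 M Y / S] and the top side at
   most [M / (1 + Y ^ 2)]; let first [S], then [Y] tend to infinity. *)
Lemma fejer_riesz a Y : 0 <= Y ->
  (\int[mu]_(y in `[0%R, Y]) (W a y)%:E <= \int[mu]_x (W x 0%R)%:E)%E.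
Proof.
move=> Y0; rewrite -/(P Y a).
have B0fin : (\int[mu]_x (W x 0%R)%:E)%E \is a fin_num.
  rewrite ge0_fin_numE; last by apply: integral_ge0 => x _; rewrite lee_fin.
  exact: le_lt_trans (WM (lexx 0)) (ltry _).
rewrite -(fineK B0fin); set b0 := fine _.
apply/lee_addgt0Pr => e e0.
(* The height is raised from [Y] to [Z], at which the top side contributes at most [e / 2]; [S]
   below is then large enough for the averaged lateral sides to contribute at most [e / 2] as
   well. *)
pose Z := Y + 2 * M / e + 1.
have Z0 : 0 < Z.
  by rewrite /Z -addrA ltr_wpDl// ltr_wpDl// divr_ge0 ?mulr_ge0// ltW.
have Ze : M / (1 + Z ^+ 2) <= e / 2.
  have ZM : 2 * M / e <= Z.
    have : 0 <= 2 * M / e by rewrite divr_ge0 ?mulr_ge0// ltW.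
    by rewrite /Z; lra.
  rewrite ler_pdivrMr ?ltr_wpDr ?sqr_ge0//.
  have -> : M = e / 2 * (2 * M / e) by field; rewrite gt_eqF.
  rewrite ler_pM2l ?divr_gt0//; apply: le_trans ZM _.
  have := sqr_ge0 (Z - 1); rewrite sqrrB expr1n mulr1; lra.
pose S := 4 * (M * Z) / e + 1.
have S0 : 0 < S.
  by rewrite ltr_wpDl// divr_ge0 ?mulr_ge0// ltW.
have Se : 2 * (M * Z) <= S * (e / 2).
  have -> : S * (e / 2) = 2 * (M * Z) + e / 2 by rewrite /S; field; rewrite gt_eqF.
  by rewrite lerDl divr_ge0// ltW.
have PYZ : (P Y a <= P Z a)%E.
  apply: ge0_subset_integral => //.
  - exact: measurable_funTS (mWr a).
  - by move=> y _; rewrite lee_fin.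
  move=> y /=; rewrite !in_itv/= => /andP[-> yY] /=; apply: le_trans yY _.
  have : 0 <= 2 * M / e by rewrite divr_ge0 ?mulr_ge0// ltW.
  by rewrite /Z; lra.
apply: le_trans PYZ _; rewrite -(@lee_pmul2l _ S%:E) ?lte_fin//.
apply: le_trans (averaged a (ltW Z0) (ltW S0)) _.
apply: (@le_trans _ _ ((S * (e / 2))%:E + S%:E * (b0%:E + (e / 2)%:E))%E).
  apply: leeD; first by rewrite lee_fin.
  rewrite lee_pmul2l ?lte_fin// -(fineK B0fin) leeD//.
  apply: le_trans (WM (ltW Z0)) _; rewrite lee_fin.
  exact: Ze.
rewrite -!(EFinD, EFinM) lee_fin; lra.
Qed.

End fejer_riesz.

(** * Convergence of complex sequences *)

Section complex_sequences.
Context {R : realType}.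
Implicit Types (c : nat -> R[i]) (l k : R[i]) (s : nat -> R).

Definition cseq_cvg c l := forall e : R, 0 < e ->
  exists N, forall n, (N <= n)%N -> cabs (c n - l) <= e.

Lemma cseq_cvg_lim c l : cseq_cvg c l -> lim ((c : nat -> R[i]^o) @ \oo) = l.
Proof.
move=> cl; apply: cvg_lim; first exact: norm_hausdorff.
apply/cvgrPdist_le => /= e e0.
have [er e0'] : e = (complex.Re e)%:C /\ 0 < complex.Re e.
  by case: e e0 => a b /=; rewrite ltcE/= => /andP[/eqP -> ->].
have [N cN] := cl _ e0'; exists N => // n /= Nn.
by rewrite distrC er cabs_norm lecR; exact: cN.
Qed.

Let bounded_nondecreasing_cvg s (B : R) : nondecreasing_seq s ->
  (forall n, s n <= B) ->
  exists t, forall e : R, 0 < e ->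
    exists N, forall n, (N <= n)%N -> `|s n - t| <= e.
Proof.
move=> ds sB; have : s @ \oo --> sup (range s).
  by apply: nondecreasing_cvgn => //; exists B => _ [n _ <-].
move=> /cvgrPdist_le st; exists (sup (range s)) => e /st[N _ sN].
by exists N => n Nn; rewrite distrC; exact: sN.
Qed.

(** Monotone convergence stands in for completeness of the plane: the real part of [c n] becomes
    nondecreasing and bounded once [s n] is added, and the limit of [s] is subtracted afterwards;
    likewise for the imaginary part. *)
Lemma cseq_majorant_cvg c s B : (forall n, s n <= B) ->
  (forall m n, (m <= n)%N -> cabs (c n - c m) <= s n - s m) ->
  exists l, cseq_cvg c l.
Proof.
move=> sB cs.
have ds : nondecreasing_seq s.
  by move=> m n mn; rewrite -subr_ge0; exact: le_trans (cabs_ge0 _) (cs _ _ mn).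
have [t st] := bounded_nondecreasing_cvg ds sB.
have part (h : R[i] -> R) : (forall z w, h (z - w) = h z - h w) ->
    (forall z, `|h z| <= cabs z) ->
    exists x, forall e : R, 0 < e ->
      exists N, forall n, (N <= n)%N -> `|h (c n) - x| <= e.
  move=> hB hle.
  have hs m n : (m <= n)%N -> `|h (c n) - h (c m)| <= s n - s m.
    by move=> mn; rewrite -hB; apply: le_trans (hle _) (cs _ _ mn).
  have [|n|x hx] := @bounded_nondecreasing_cvg (fun n => h (c n) + s n)
      (h (c 0%N) + (B - s 0%N) + B).
  - by move=> m n /hs; rewrite ler_norml => /andP[? ?]; lra.
  - by have := hs _ _ (leq0n n); have := sB n; rewrite ler_norml;
      move=> ? /andP[? ?]; lra.
  exists (x - t) => e e0; have e2 : 0 < e / 2 by rewrite divr_gt0.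
  have [N1 h1] := hx _ e2; have [N2 h2] := st _ e2.
  exists (maxn N1 N2) => n; rewrite geq_max => /andP[/h1 + /h2].
  by rewrite !ler_norml => /andP[? ?] /andP[? ?]; apply/andP; split; lra.
have [x cx] := part (@complex.Re R) (@ReB R) (@ler_Re_cabs R).
have [y cy] := part (@complex.Im R) (@ImB R) (@ler_Im_cabs R).
exists (x +i* y) => e e0.
have e2 : 0 < e / 2 by rewrite divr_gt0.
have [N1 h1] := cx _ e2; have [N2 h2] := cy _ e2.
exists (maxn N1 N2) => n; rewrite geq_max => /andP[/h1 h1n /h2 h2n].
by apply: le_trans (cabs_le_ReIm _) _; rewrite ReB ImB/=; lra.
Qed.

Lemma cseq_cvg_unique c l k : cseq_cvg c l -> cseq_cvg c k -> l = k.
Proof. by move=> /cseq_cvg_lim <- /cseq_cvg_lim <-. Qed.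

Lemma cseq_cvg_cst l : cseq_cvg (fun=> l) l.
Proof. by move=> e e0; exists 0%N => n _; rewrite subrr cabs0 ltW. Qed.

Lemma cseq_cvgD c d l k :
  cseq_cvg c l -> cseq_cvg d k -> cseq_cvg (fun n => c n + d n) (l + k).
Proof.
move=> cl dk e e0; have e2 : 0 < e / 2 by rewrite divr_gt0.
have [N1 h1] := cl _ e2; have [N2 h2] := dk _ e2.
exists (maxn N1 N2) => n; rewrite geq_max => /andP[/h1 c1 /h2 d2].
by rewrite opprD addrACA; apply: le_trans (cabsD _ _) _; lra.
Qed.

Lemma cseq_cvgM c d l k :
  cseq_cvg c l -> cseq_cvg d k -> cseq_cvg (fun n => c n * d n) (l * k).
Proof.
move=> cl dk e e0.
pose L := cabs l + cabs k + 1.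
have L1 : 1 <= L by rewrite lerDr addr_ge0 ?cabs_ge0.
pose e1 := Num.min (e / (2 * L)) 1.
have e10 : 0 < e1.
  by rewrite lt_min ltr01 andbT divr_gt0// mulr_gt0//; lra.
have e1e : e1 <= e / (2 * L) by rewrite ge_min lexx.
have e11 : e1 <= 1 by rewrite ge_min lexx orbT.
have [N1 h1] := cl _ e10; have [N2 h2] := dk _ e10.
exists (maxn N1 N2) => n; rewrite geq_max => /andP[/h1 c1 /h2 d2].
rewrite (_ : _ - _ = (c n - l) * (d n - k) + (c n - l) * k + l * (d n - k)); last by ring.
apply: le_trans (cabsD _ _) _; apply: le_trans (lerD (cabsD _ _) (lexx _)) _.
rewrite !cabsM.
apply: (@le_trans _ _ (e1 * 1 + e1 * cabs k + cabs l * e1)).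
  have := cabs_ge0 (c n - l); have := cabs_ge0 (d n - k).
  move=> h3 h4; apply: lerD; first apply: lerD.
  - by apply: ler_pM => //; exact: le_trans d2 e11.
  - by apply: ler_wpM2r => //; exact: cabs_ge0.
  - by apply: ler_wpM2l => //; exact: cabs_ge0.
rewrite (_ : _ + _ = e1 * L); last by rewrite /L; ring.
apply: le_trans (ler_wpM2r _ e1e) _; first lra.
rewrite (_ : _ / _ * _ = e / 2); first lra.
by field; lra.
Qed.

Lemma cseq_cvg_dist_le c l k (B : R) : cseq_cvg c l ->
  (forall n, cabs (c n - k) <= B) -> cabs (l - k) <= B.
Proof.
move=> cl ck; apply/ler_addgt0Pr => e e0; have [N /(_ _ (leqnn N)) cN] := cl _ e0.
rewrite (_ : l - k = (c N - k) + - (c N - l)); last by ring.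
by apply: le_trans (cabsD _ _) _; rewrite cabsN lerD.
Qed.

Lemma cseq_cvg_ge c l (B : R) m : cseq_cvg c l ->
  (forall n, (m <= n)%N -> B <= cabs (c n)) -> B <= cabs l.
Proof.
move=> cl cB; apply/ler_addgt0Pr => e e0; have [N cN] := cl _ e0.
apply: le_trans (cB _ (leq_maxl m N)) _.
rewrite -[X in cabs X](subrK l); apply: le_trans (cabsD _ _) _.
by rewrite addrC lerD2l; apply: cN; exact: leq_maxr.
Qed.

Lemma cseq_cvg_le c l (B : R) m : cseq_cvg c l ->
  (forall n, (m <= n)%N -> cabs (c n) <= B) -> cabs l <= B.
Proof.
move=> cl cB; apply/ler_addgt0Pr => e e0; have [N cN] := cl _ e0.
rewrite (_ : l = c (maxn m N) - (c (maxn m N) - l)); last by ring.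
apply: le_trans (cabsD _ _) _; rewrite cabsN; apply: lerD.
  by apply: cB; exact: leq_maxl.
by apply: cN; exact: leq_maxr.
Qed.

End complex_sequences.

(** * Infinite products and geometric majorants *)

Section infinite_products.
Context {R : realType}.
Variables (v : nat -> R[i]) (a : nat -> R).
Hypothesis va : forall n, cabs (v n) <= a n.

Let prod_v N : R[i] := \prod_(n < N) (1 + v n).
Let prod_a N : R := \prod_(n < N) (1 + a n).

Let a_ge0 n : 0 <= a n. Proof. exact: le_trans (cabs_ge0 _) (va n). Qed.

Lemma prod_1D_ge1 N : 1 <= \prod_(n < N) (1 + a n).
Proof.
elim: N => [|N IH]; first by rewrite big_ord0.
by rewrite big_ord_recr/=; apply: mulr_ege1 => //; rewrite lerDl.
Qed.

Lemma prod_1D_le_expR N : \prod_(n < N) (1 + a n) <= expR (\sum_(n < N) a n).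
Proof.
elim: N => [|N IH]; first by rewrite !big_ord0 expR0.
rewrite !big_ord_recr/= expRD; apply: ler_pM => //.
- exact: le_trans ler01 (prod_1D_ge1 N).
- by rewrite addr_ge0.
- exact: expR_ge1Dx.
Qed.

(** Second-order remainder for differentiating an infinite product. In the induction, with partial
    sum [S] and new term [b], the two sides differ by [S * b * (1 - S) + b ^ 2]. *)
Lemma prod_1D_le_quadratic N : \sum_(n < N) a n <= 1 ->
  \prod_(n < N) (1 + a n) <=
  1 + \sum_(n < N) a n + (\sum_(n < N) a n) ^+ 2.
Proof.
elim: N => [|N IH]; first by rewrite !big_ord0 expr0n/= !addr0.
rewrite !big_ord_recr/= => S1; have aN := a_ge0 N.
have S0 : 0 <= \sum_(n < N) a n by exact: sumr_ge0.
have {}IH := IH ltac:(lra).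
apply: le_trans (ler_wpM2r _ IH) _; first by rewrite addr_ge0.
move: (\sum_(n < N) a n) (a N) S0 aN S1 => S b S0 b0 Sb.
have S1' : 0 <= 1 - S by lra.
have := mulr_ge0 (mulr_ge0 S0 b0) S1'; have := sqr_ge0 b; lra.
Qed.

Lemma cabs_prod_1D N : cabs (prod_v N) <= prod_a N.
Proof.
rewrite /prod_v /prod_a; elim: N => [|N IH]; first by rewrite !big_ord0 cabs1.
rewrite !big_ord_recr/= cabsM; apply: ler_pM => //; try exact: cabs_ge0.
by apply: le_trans (cabsD _ _) _; rewrite cabs1 lerD2l.
Qed.

(** Expanded into monomials in the [v n], the difference has nonnegative coefficients, hence is
    dominated term by term by the same expression in the [a n]. The same principle gives
    [prod_1D_linear_dist]. *)
Lemma prod_1D_dist M N : (M <= N)%N ->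
  cabs (prod_v N - prod_v M) <= prod_a N - prod_a M.
Proof.
move=> /subnKC <-; elim: (N - M)%N => [|n IH].
  by rewrite addn0 !subrr cabs0.
rewrite addnS /prod_v /prod_a big_ord_recr/= [in leRHS]big_ord_recr/=.
rewrite -/(prod_v _) -/(prod_a _).
rewrite (_ : _ - _ = (prod_v (M + n) - prod_v M) + prod_v (M + n) * v (M + n));
  last by rewrite /prod_v; ring.
apply: le_trans (cabsD _ _) _; rewrite cabsM.
have := ler_pM (cabs_ge0 _) (cabs_ge0 _) (cabs_prod_1D (M + n)) (va (M + n)).
move: IH; rewrite /prod_a /prod_v; lra.
Qed.

Lemma prod_1D_linear_dist N :
  cabs (prod_v N - 1 - \sum_(n < N) v n) <= prod_a N - 1 - \sum_(n < N) a n.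
Proof.
rewrite /prod_v /prod_a.
elim: N => [|N IH]; first by rewrite !big_ord0 !subrr cabs0.
have := prod_1D_dist (leq0n N); rewrite /prod_v /prod_a !big_ord0 => h.
rewrite !big_ord_recr/=.
rewrite (_ : _ - _ - _ = (\prod_(i < N) (1 + v i) - 1 - \sum_(i < N) v i) +
  (\prod_(i < N) (1 + v i) - 1) * v N); last by ring.
apply: le_trans (cabsD _ _) _; rewrite cabsM.
have := ler_pM (cabs_ge0 _) (cabs_ge0 _) h (va N).
move: IH; lra.
Qed.

Lemma prod_1D_cvg B : (forall N, \sum_(n < N) a n <= B) ->
  exists l, cseq_cvg (fun N => \prod_(n < N) (1 + v n)) l.
Proof.
move=> aB; apply: (cseq_majorant_cvg (s := prod_a) (B := expR B)).
  by move=> n; apply: le_trans (prod_1D_le_expR n) _; rewrite ler_expR.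
exact: prod_1D_dist.
Qed.

Lemma cseries_cvg B : (forall N, \sum_(n < N) a n <= B) ->
  exists l, cseq_cvg (fun N => \sum_(n < N) v n) l.
Proof.
move=> aB; apply: (cseq_majorant_cvg (s := fun N => \sum_(n < N) a n) (B := B)) => //.
move=> M N /subnKC <-; elim: (N - M)%N => [|n IH].
  by rewrite addn0 !subrr cabs0.
rewrite addnS big_ord_recr/= [in leRHS]big_ord_recr/=.
rewrite addrAC [in leRHS]addrAC.
by apply: le_trans (cabsD _ _) _; apply: lerD.
Qed.

End infinite_products.

Section geometric_sums.
Context {R : realType}.
Variable q : R.
Hypothesis q1 : 1 < q.

Let rX_ge0 n : 0 <= q^-1 ^+ n.
Proof. by rewrite exprn_ge0// invr_ge0 ltW// (lt_trans ltr01). Qed.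

Lemma sum_geometric_inv N :
  \sum_(n < N) q^-1 ^+ n.+1 = (1 - q^-1 ^+ N) / (q - 1).
Proof.
have q0 : q != 0 by rewrite gt_eqF// (lt_trans ltr01).
have q10 : q - 1 != 0 by rewrite gt_eqF// subr_gt0.
elim: N => [|N IH]; first by rewrite big_ord0 expr0 subrr mul0r.
by rewrite big_ord_recr/= IH !exprS; field; rewrite q0 q10.
Qed.

Lemma sum_geometric_inv_le N : \sum_(n < N) q^-1 ^+ n.+1 <= (q - 1)^-1.
Proof.
rewrite sum_geometric_inv ler_pdivrMr ?subr_gt0// mulVf; last first.
  by rewrite gt_eqF// subr_gt0.
by rewrite lerBlDr lerDl; exact: rX_ge0.
Qed.

Lemma prod_1D_geometric_le N : \prod_(n < N) (1 + q^-1 ^+ n) <= expR (q / (q - 1)).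
Proof.
have h n : cabs ((q^-1 ^+ n)%:C : R[i]) <= q^-1 ^+ n.
  by rewrite cabs_real ger0_norm.
apply: le_trans (prod_1D_le_expR h N) _; rewrite ler_expR.
have -> : \sum_(n < N) q^-1 ^+ n = q * \sum_(n < N) q^-1 ^+ n.+1.
  rewrite mulr_sumr; apply: eq_bigr => n _.
  by rewrite exprS mulVKf// gt_eqF// (lt_trans ltr01).
by rewrite ler_wpM2l ?sum_geometric_inv_le// ltW// (lt_trans ltr01).
Qed.

End geometric_sums.

(** * Size and differentiability of the canonical product *)

Section canonical_product.
Context {R : realType}.
Variables (q : R) (G : R[i] -> R[i]).
Hypothesis q1 : 1 < q.
Let r := q^-1.

(** The factor vanishing at [- i q^(n+1)], written in the form [1 + v n] used for infinite
    products. *)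
Definition lower_factor n (z : R[i]) : R[i] := 1 + z * (- 'i * (q^-1 ^+ n.+1)%:C).

Hypothesis canonical_product_cvg : forall z,
  cseq_cvg (fun N => \prod_(n < N) lower_factor n z) (G z).

Let q_gt0 : 0 < q. Proof. exact: lt_trans ltr01 q1. Qed.

Let r_gt0 : 0 < r. Proof. by rewrite invr_gt0. Qed.

Let rX_ge0 n : 0 <= r ^+ n. Proof. by rewrite exprn_ge0// ltW. Qed.

Lemma cabs_root_inv n : cabs (- 'i * (q^-1 ^+ n.+1)%:C : R[i]) = q^-1 ^+ n.+1.
Proof.
rewrite cabsM cabs_real ger0_norm; last exact: (rX_ge0 n.+1).
by rewrite cabsN /cabs/= expr0n expr1n add0r sqrtr1 mul1r.
Qed.

Lemma sqr_cabs_lower_factor n x y : cabs (lower_factor n (x +i* y)) ^+ 2 =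
  (1 + y * q^-1 ^+ n.+1) ^+ 2 + (x * q^-1 ^+ n.+1) ^+ 2.
Proof. by rewrite sqr_cabs /=; ring. Qed.

Lemma lower_factor_ge1 n z : 0 <= complex.Im z -> 1 <= cabs (lower_factor n z).
Proof.
case: z => x y y0; rewrite -(@ler_sqr _ 1) ?nnegrE ?cabs_ge0//.
rewrite sqr_cabs_lower_factor expr1n.
have yr := mulr_ge0 y0 (rX_ge0 n.+1); rewrite -/r.
have := sqr_ge0 (x * r ^+ n.+1); have := sqr_ge0 (y * r ^+ n.+1).
by move: yr; move: (y * _) (x * _) => u v; lra.
Qed.

Lemma lower_factor_ge n z : 0 <= complex.Im z ->
  cabs z * q^-1 ^+ n.+1 <= cabs (lower_factor n z).
Proof.
case: z => x y y0; rewrite -ler_sqr ?nnegrE ?mulr_ge0 ?cabs_ge0//.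
rewrite sqr_cabs_lower_factor exprMn sqr_cabs/=.
have yr := mulr_ge0 y0 (rX_ge0 n.+1); rewrite -/r mulrDl -!exprMn.
by move: yr; move: (y * _) (x * _) => u v; lra.
Qed.

Lemma lower_factor_le n z : cabs (lower_factor n z) <= 1 + cabs z * q^-1 ^+ n.+1.
Proof.
by apply: le_trans (cabsD _ _) _; rewrite cabs1 cabsM cabs_root_inv.
Qed.

(** In the upper half-plane a factor is at least [|z| / q^(n+1)] and at least 1; the first bound is
    used for the first [k] factors, the second for the others. *)
Lemma canonical_product_ge k z : 0 <= complex.Im z ->
  cabs z ^+ k * \prod_(n < k) q^-1 ^+ n.+1 <= cabs (G z).
Proof.
move=> z0; apply: (cseq_cvg_ge (canonical_product_cvg z) (m := k)) => N /subnKC <-.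
rewrite big_split_ord/= cabsM.
rewrite -[leLHS]mulr1; apply: ler_pM.
- by rewrite mulr_ge0 ?exprn_ge0 ?cabs_ge0// prodr_ge0// => i _; exact: rX_ge0.
- exact: ler01.
- elim: k => [|k IH]; first by rewrite !big_ord0 cabs1 mulr1.
  rewrite !big_ord_recr/= cabsM exprSr mulrACA; apply: ler_pM => //.
  + by rewrite mulr_ge0 ?exprn_ge0 ?cabs_ge0// prodr_ge0// => i _; exact: rX_ge0.
  + by rewrite mulr_ge0 ?cabs_ge0//; exact: (rX_ge0 k.+1).
  + exact: lower_factor_ge.
- elim: (N - k)%N => [|m IH]; first by rewrite big_ord0 cabs1.
  by rewrite big_ord_recr/= cabsM mulr_ege1//; exact: lower_factor_ge1.
Qed.

Lemma canonical_product_neq0 z : 0 <= complex.Im z -> G z != 0.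
Proof.
move=> z0; rewrite -cabs_gt0; apply: lt_le_trans ltr01 _.
by have := canonical_product_ge 0 z0; rewrite big_ord0 expr0 mul1r.
Qed.

(** On the [k]-th ring the factor of index [k + m] is at most [1 + q^(- m)], and that of index
    [n < k] exceeds [|z| / q^(n+1)] by a factor at most [1 + q^(- (k - n - 1))]. Both families of
    corrections are bounded by the same geometric product, whence the square. *)
Lemma canonical_product_le k z : 0 <= complex.Im z -> ((0 < k)%N -> q ^+ k <= cabs z) ->
  cabs z <= q ^+ k.+1 ->
  cabs (G z) <= expR (q / (q - 1)) ^+ 2 *
                (cabs z ^+ k * \prod_(n < k) q^-1 ^+ n.+1).
Proof.
move=> z0 zk zk1.
apply: (cseq_cvg_le (canonical_product_cvg z) (m := k)) => N /subnKC <-.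
rewrite big_split_ord/= cabsM expr2 mulrC -mulrA; apply: ler_pM; try exact: cabs_ge0.
- apply: le_trans (prod_1D_geometric_le q1 (N - k)).
  elim: (N - k)%N => [|m IH]; first by rewrite !big_ord0 cabs1.
  rewrite !big_ord_recr/= cabsM; apply: ler_pM => //; try exact: cabs_ge0.
  apply: le_trans (lower_factor_le _ _) _; rewrite lerD2l.
  apply: le_trans (ler_wpM2r _ zk1) _; first exact: (rX_ge0 _.+1).
  by rewrite -addSn exprD mulrA -exprMn divff ?gt_eqF// expr1n mul1r.
- apply: (@le_trans _ _ ((\prod_(n < k) (1 + q^-1 ^+ n)) *
    (cabs z ^+ k * \prod_(n < k) q^-1 ^+ n.+1))); last first.
    apply: ler_wpM2r; last exact: prod_1D_geometric_le.
    by rewrite mulr_ge0 ?exprn_ge0 ?cabs_ge0// prodr_ge0// => i _; exact: rX_ge0.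
  rewrite [X in _ <= X * _](reindex_inj rev_ord_inj)/=.
  rewrite -[k in cabs z ^+ k]card_ord -prodr_const.
  rewrite -!big_split/= (big_morph _ (@cabsM R) (@cabs1 R)).
  apply: ler_prod => n _; rewrite cabs_ge0/=.
  apply: le_trans (lower_factor_le _ _) _.
  rewrite mulrDl mul1r [leLHS]addrC lerD2l.
  have kz : q ^+ k <= cabs z by apply: zk; apply: leq_ltn_trans (ltn_ord n).
  apply: (@le_trans _ _ (q^-1 ^+ (k - n.+1) * (q ^+ k * q^-1 ^+ n.+1))).
    rewrite mulrCA -exprD subnK ?ltn_ord// -exprMn divff ?gt_eqF//.
    by rewrite expr1n.
  apply: ler_wpM2l; first exact: rX_ge0.
  by apply: ler_wpM2r => //; exact: (rX_ge0 n.+1).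
Qed.

(** Dividing each factor at [z + w] by its value at [z] gives [G (z + w) = G z * P], with [P] the
    product of the [1 + w * u n] and [u n] the logarithmic derivative of the factor. The derivative
    is then [G z] times the sum of the [u n], up to a quadratic error in [w]. *)
Lemma canonical_product_cdiff z : 0 <= complex.Im z -> cdiff G z.
Proof.
move=> z0.
pose u n : R[i] := (- 'i * (q^-1 ^+ n.+1)%:C) / lower_factor n z.
have f0 n : lower_factor n z != 0.
  by rewrite -cabs_gt0; apply: lt_le_trans ltr01 _; exact: lower_factor_ge1.
have ur n : cabs (u n) <= q^-1 ^+ n.+1.
  rewrite /u cabsM cabsV cabs_root_inv ler_pdivrMr ?cabs_gt0//.
  by rewrite ler_peMr ?lower_factor_ge1//; exact: (rX_ge0 n.+1).
have S0 : 0 < (q - 1)^-1 by rewrite invr_gt0 subr_gt0.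
set S := (q - 1)^-1 in S0.
have sumS N : \sum_(n < N) q^-1 ^+ n.+1 <= S by exact: sum_geometric_inv_le.
have [U U_cvg] := cseries_cvg ur sumS.
have wur w n : cabs (w * u n) <= cabs w * q^-1 ^+ n.+1.
  by rewrite cabsM ler_wpM2l// cabs_ge0.
have wsum w N : \sum_(n < N) cabs w * q^-1 ^+ n.+1 <= cabs w * S.
  by rewrite -mulr_sumr ler_wpM2l// cabs_ge0.
exists (G z * U) => e e0.
pose D := (cabs (G z) + 1) * S ^+ 2.
have D0 : 0 < D.
  by rewrite mulr_gt0 ?exprn_gt0// ltr_wpDl// cabs_ge0.
(* [S^-1] keeps the sum of the majorants at most 1, as [prod_1D_le_quadratic] demands; [e / D] turns
   the quadratic error into [e * cabs w]. *)
exists (Num.min S^-1 (e / D)); first by rewrite lt_min invr_gt0 S0 divr_gt0.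
move=> w; rewrite lt_min ltr_pdivlMr// => /andP[wS wD].
have wS1 : cabs w * S <= 1 by rewrite -ler_pdivlMr// div1r ltW.
have [P P_cvg] := prod_1D_cvg (wur w) (wsum w).
have GP : G (z + w) = G z * P.
  apply: cseq_cvg_unique (canonical_product_cvg (z + w)) _.
  rewrite (_ : (fun _ => _) = fun N =>
    \prod_(n < N) lower_factor n z * \prod_(n < N) (1 + w * u n)).
    exact: cseq_cvgM.
  apply/funext => N; rewrite -big_split/=; apply: eq_bigr => n _.
  by rewrite /u mulrDr mulr1 mulrCA [lower_factor n z * _]mulrC divfK// /lower_factor; ring.
have PU : cabs (P - (1 + w * U)) <= (cabs w * S) ^+ 2.
  have h : cseq_cvg (fun N => \prod_(n < N) (1 + w * u n) +
      (-1) * (1 + w * \sum_(n < N) u n)) (P + (-1) * (1 + w * U)).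
    apply: cseq_cvgD => //; apply: cseq_cvgM; first exact: cseq_cvg_cst.
    apply: cseq_cvgD; first exact: cseq_cvg_cst.
    by apply: cseq_cvgM => //; exact: cseq_cvg_cst.
  rewrite (_ : P - _ = (P + (-1) * (1 + w * U)) - 0); last by ring.
  apply: (cseq_cvg_dist_le h) => N.
  rewrite (_ : _ - 0 = \prod_(n < N) (1 + w * u n) - 1 - \sum_(n < N) (w * u n)); last first.
    by rewrite -mulr_sumr; ring.
  apply: le_trans (prod_1D_linear_dist (wur w) N) _.
  have h1 := le_trans (wsum w N) wS1.
  have h2 := prod_1D_le_quadratic (wur w) h1.
  have h3 : (\sum_(n < N) cabs w * q^-1 ^+ n.+1) ^+ 2 <= (cabs w * S) ^+ 2.
    rewrite ler_sqr ?nnegrE//; last by rewrite mulr_ge0 ?cabs_ge0// ltW.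
    by apply: sumr_ge0 => i _; rewrite mulr_ge0 ?cabs_ge0//; exact: (rX_ge0 i.+1).
  move: h2 h3; lra.
rewrite GP (_ : _ - _ - _ = G z * (P - (1 + w * U))); last by ring.
rewrite cabsM; apply: le_trans (ler_wpM2l (cabs_ge0 _) PU) _.
apply: (@le_trans _ _ (cabs w * D * cabs w)).
  rewrite /D exprMn mulrCA mulrA -mulrA [leRHS]mulrAC.
  rewrite expr2 -!mulrA ler_wpM2l ?cabs_ge0// ler_wpM2l ?cabs_ge0//.
  by rewrite ler_wpM2r ?sqr_ge0// lerDl.
by apply: ler_wpM2r; [exact: cabs_ge0|exact: ltW].
Qed.

End canonical_product.

(** * The generating function and the weight on the rings *)

Section generating_function.
Context {R : realType}.
Variable alpha : R.
Hypothesis alpha_gt0 : 0 < alpha.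

Definition ratio : R := expR (2 * alpha)^-1.

Lemma ratio_gt1 : 1 < ratio.
Proof. by rewrite -expR0 ltr_expR invr_gt0 mulr_gt0. Qed.

Lemma ratioX n : ratio ^+ n = expR (n%:R / (2 * alpha)).
Proof. by rewrite /ratio -expRM_natl. Qed.

Lemma ring_index (z : R[i]) : exists k,
  ((0 < k)%N -> ratio ^+ k <= cabs z) /\ cabs z <= ratio ^+ k.+1.
Proof.
have a2 : 0 < 2 * alpha by rewrite mulr_gt0.
have ex : exists k, cabs z <= ratio ^+ k.+1.
  have z0 : 0 <= cabs z * (2 * alpha) by rewrite mulr_ge0 ?cabs_ge0// ltW.
  have := archi_boundP z0; set N := Num.bound _ => zN; exists N.
  rewrite ratioX; apply: le_trans (expR_ge1Dx _).
  apply: ler_wpDl => //; rewrite ler_pdivlMr//; apply/ltW/(lt_trans zN).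
  by rewrite ltr_nat.
case: (ex_minnP ex) => k zk kmin; exists k; split => //.
case: k zk kmin => // k zk kmin _; rewrite leNgt; apply/negP => /ltW /kmin.
by rewrite ltnn.
Qed.

Lemma gamma_pt_factor n z : 1 - z / gamma_pt alpha n = lower_factor ratio n z.
Proof.
rewrite /lower_factor -mulrN; congr (_ + _ * _).
rewrite /gamma_pt -ratioX exprVn; set p := ratio ^+ n.+1.
have p0 : p != 0 by rewrite gt_eqF// exprn_gt0// (lt_trans ltr01 ratio_gt1).
have g0 : (0 -i* p) != 0 :> R[i] by rewrite eq_complex/= eqxx oppr_eq0.
apply: (mulfI g0); rewrite mulrN divff//.
by apply/eqP; rewrite eq_complex /=; apply/andP; split; apply/eqP => /=; field.
Qed.

Lemma genfun_cvg z :
  cseq_cvg (fun N => \prod_(n < N) lower_factor ratio n z) (genfun alpha z).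
Proof.
have va n : cabs (z * (- 'i * (ratio^-1 ^+ n.+1)%:C)) <= cabs z * ratio^-1 ^+ n.+1.
  by rewrite cabsM (cabs_root_inv ratio_gt1).
have [|l zl] := prod_1D_cvg va (B := cabs z * (ratio - 1)^-1).
  move=> N; rewrite -mulr_sumr ler_wpM2l ?cabs_ge0//.
  exact/sum_geometric_inv_le/ratio_gt1.
suff -> : genfun alpha z = l by [].
apply: (cseq_cvg_lim (c := fun N => \prod_(n < N) (1 - z / gamma_pt alpha n))).
rewrite (_ : (fun N => _) =
    (fun N => \prod_(n < N) (1 + z * (- 'i * (ratio^-1 ^+ n.+1)%:C)))) //.
by apply/funext => N; apply: eq_bigr => n _; rewrite gamma_pt_factor.
Qed.

Lemma sqr_prod_geometric k :
  (\prod_(n < k) ratio^-1 ^+ n.+1) ^+ 2 = (ratio ^+ (k * k.+1))^-1.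
Proof.
rewrite -exprVn; elim: k => [|k IH]; first by rewrite big_ord0 expr1n.
rewrite big_ord_recr/= exprMn IH -exprM -exprD; congr (_ ^+ _).
by nia.
Qed.

Lemma weight0 (z : R[i]) : cabs z = 0 -> weight alpha z = 0.
Proof. by move=> z0; rewrite /weight /logplus z0 ln0// maxxx expr0n mulr0. Qed.

(* [exp (2 phi)] is, up to bounded factors, the maximum over [k] of
   [|z| ^ (2 k) / ratio ^ (k ^ 2)], attained on the [k]-th ring. *)
Lemma weight_peak k z :
  cabs z ^+ (2 * k) * expR (- (2 * weight alpha z)) <= ratio ^+ (k * k).
Proof.
have [z0|z0] := eqVneq (cabs z) 0.
  rewrite weight0// z0 mulr0 oppr0 expR0 mulr1.
  apply: (@le_trans _ _ 1); last by rewrite exprn_ege1// ltW// ratio_gt1.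
  by rewrite exprn_ile1// ler01.
have zp : 0 < cabs z by rewrite lt_def z0 cabs_ge0.
rewrite /weight /logplus -{1}(lnK zp) -expRM_natl -expRD ratioX ler_expR.
set L := ln _; set m := Num.max L 0.
have Lm : L <= m by rewrite le_max lexx.
have kL : (2 * k)%:R * L <= 2 * k%:R * m by rewrite natrM ler_wpM2l.
apply: le_trans (lerD kL (lexx _)) _.
(* Completing the square: [2 * alpha] times this square is the gap between the two exponents once
   [L] has been replaced by [m]. *)
have := sqr_ge0 (m - k%:R / (2 * alpha)).
have -> : (k * k)%:R / (2 * alpha) = k%:R ^+ 2 / (2 * alpha) by rewrite natrM expr2.
have a2 : 0 < 2 * alpha by rewrite mulr_gt0.
move/(mulr_ge0 (ltW a2)).
rewrite (_ : 2 * alpha * _ = 2 * (alpha * m ^+ 2) - 2 * k%:R * m + k%:R ^+ 2 / (2 * alpha)).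
  by lra.
by field; rewrite gt_eqF.
Qed.

(** With [lam = log q], the enlarged ring satisfies [|log |z| - k lam| <= 2 lam], so the loss in
    [weight_peak] is at most [2 alpha (2 lam)^2 = 4 lam], the logarithm of [ratio ^+ 4]. For [k = 0]
    the truncated logarithm is used, since the ring contains the disc. *)
Lemma weight_near_peak k z : ((0 < k)%N -> ratio ^+ k.-1 <= cabs z) ->
  cabs z <= ratio ^+ k.+2 ->
  ratio ^+ (k * k) <= ratio ^+ 4 * (cabs z ^+ (2 * k) * expR (- (2 * weight alpha z))).
Proof.
move=> zk zk2.
have a2 : 0 < 2 * alpha by rewrite mulr_gt0.
pose lam := (2 * alpha)^-1.
have lam0 : 0 < lam by rewrite invr_gt0.
have al : 2 * alpha * lam = 1 by rewrite mulfV// gt_eqF.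
have [z0|z0] := eqVneq (cabs z) 0.
  have k0 : k = 0%N.
    case: k zk zk2 => // k /(_ isT) + _; rewrite z0 leNgt exprn_gt0//.
    exact: lt_trans ltr01 ratio_gt1.
  rewrite k0 mul0n muln0 !expr0 mul1r weight0// mulr0 oppr0 expR0 mulr1.
  by rewrite exprn_ege1// ltW// ratio_gt1.
have zp : 0 < cabs z by rewrite lt_def z0 cabs_ge0.
have Lk2 : ln (cabs z) <= k.+2%:R * lam.
  by rewrite -[leRHS]expRK -/lam ler_ln ?posrE ?expR_gt0// -ratioX.
have Lk : (0 < k)%N -> k.-1%:R * lam <= ln (cabs z).
  move=> /zk h; rewrite -[leLHS]expRK ler_ln ?posrE ?expR_gt0//.
  by rewrite -ratioX.
rewrite /weight /logplus -{1}(lnK zp) -expRM_natl !ratioX -!expRD ler_expR -/lam.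
move: Lk Lk2; set L := ln _; set m := Num.max L 0 => Lk Lk2.
have m0 : 0 <= m by rewrite le_max lexx orbT.
case: k Lk Lk2 {zk zk2} => [|k] Lk Lk2.
  rewrite !muln0 mul0r mul0r add0r.
  have m2 : m <= 2 * lam.
    by rewrite ge_max Lk2/= mulr_ge0// ltW.
  have : m ^+ 2 <= (2 * lam) ^+ 2 by rewrite ler_sqr ?nnegrE// mulr_ge0// ltW.
  move/(ler_wpM2l (ltW a2)).
  rewrite [X in _ <= X](_ : _ = (2 * alpha * lam) * (4 * lam)); last by ring.
  by rewrite al mul1r; lra.
have L0 : 0 <= L by apply: le_trans (Lk isT); rewrite mulr_ge0// ltW.
have mL : m = L by rewrite /m max_l.
rewrite mL.
have h1 := Lk isT; rewrite /= in h1.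
have kn : k.+1%:R = k%:R + 1 :> R by rewrite -natr1.
have kn3 : k.+3%:R = k%:R + 3 :> R by rewrite -!natr1; ring.
rewrite kn3 in Lk2.
have : (L - (k%:R + 1) * lam) ^+ 2 <= (2 * lam) ^+ 2.
  rewrite -(real_normK (num_real (L - _))) ler_sqr ?nnegrE ?normr_ge0//.
    by rewrite ler_norml; lra.
  by rewrite mulr_ge0// ltW.
move/(ler_wpM2l (ltW a2)).
rewrite [X in _ <= X](_ : _ = (2 * alpha * lam) * (4 * lam)); last by ring.
rewrite [X in X <= _](_ : _ = 2 * (alpha * L ^+ 2) - (2 * alpha * lam) * (2 * (k%:R + 1) * L) +
  (2 * alpha * lam) * ((k%:R + 1) ^+ 2 * lam)); last by ring.
by rewrite al !mul1r !natrM kn expr2; lra.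
Qed.

End generating_function.

(** * Bumps adapted to the rings and rational localizers *)

Section localizers.
Context {R : realType}.
Variable q : R.
Hypothesis q1 : 1 < q.

(** In the variable [log T], a bump of height [1/4] centred at [T = q^(2k)] with exponential tails.
    It is minus the derivative of [T / (T + X)] with respect to [log X] at [X = q^(2k)]. Taking
    [T = 1 + |z|^2] puts the unit disc with the ring [k = 0]. *)
Definition kappa k (T : R) := q ^+ (2 * k) * T / (T + q ^+ (2 * k)) ^+ 2.

Let q_gt0 : 0 < q. Proof. exact: lt_trans ltr01 q1. Qed.

Let qX_ge1 n : 1 <= q ^+ n. Proof. by rewrite exprn_ege1// ltW. Qed.

Lemma kappa_ge0 k T : 0 <= T -> 0 <= kappa k T.
Proof.
by move=> T0; rewrite divr_ge0 ?sqr_ge0// mulr_ge0// exprn_ge0// ltW.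
Qed.

(* The terms are dominated by the increments of [k |-> T / (T + q ^ (2 k))]. *)
Lemma sum_kappa_le n T : 0 < T ->
  \sum_(k < n) kappa k T <= q ^+ 2 / (q ^+ 2 - 1).
Proof.
move=> T0; have Q1 : 1 < q ^+ 2 by rewrite exprn_egt1.
pose Q := q ^+ 2; rewrite -/Q in Q1 *.
have Q10 : 0 < Q - 1 by rewrite subr_gt0.
pose h k := T / (T + Q ^+ k).
have TQ k : 0 < T + Q ^+ k by rewrite addr_gt0// exprn_gt0// (lt_trans ltr01).
have step k : kappa k T <= Q / (Q - 1) * (h k - h k.+1).
  rewrite /kappa exprM -/Q /h (exprS Q k); move: (TQ k) (TQ k.+1); rewrite (exprS Q k).
  move: (exprn_gt0 k (lt_trans ltr01 Q1)); move: (Q ^+ k) => X X0 TX TQX.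
  rewrite [leRHS](_ : _ = X * T / (T + X) * (Q / (T + Q * X))); last first.
    by field; rewrite !gt_eqF.
  rewrite [(_ + _) ^+ 2]expr2 invfM [leLHS]mulrA; apply: ler_wpM2l.
    by rewrite divr_ge0// ?mulr_ge0 ?ltW.
  rewrite ler_pdivlMr// mulrC ler_pdivrMr//.
  have := mulr_gt0 Q10 T0; lra.
apply: (@le_trans _ _ (Q / (Q - 1) * (h 0%N - h n))); last first.
  apply: ler_piMr; first by rewrite divr_ge0 ?ltW// (lt_trans ltr01).
  rewrite lerBlDr; apply: ler_wpDr; first by rewrite divr_ge0 ?ltW.
  by rewrite ler_pdivrMr// mul1r lerDl exprn_ge0// ltW// (lt_trans ltr01).
elim: n => [|n IH]; first by rewrite big_ord0 subrr mulr0.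
rewrite big_ord_recr/=; apply: le_trans (lerD IH (step n)) _.
by rewrite -mulrDr addrA subrK.
Qed.

(** With [T = 1 + t^2] and [X = q^(2k)] one has [T <= 2 q^4 X] and [X <= q^2 T]; the second bounds
    the denominator by [((1 + q^2) T)^2], the first the remaining quotient [T / X]. *)
Lemma kappa_ring_ge k (t : R) : ((0 < k)%N -> q ^+ k.-1 <= t) -> 0 <= t ->
  t <= q ^+ k.+2 ->
  (2 * q ^+ 4 * (1 + q ^+ 2) ^+ 2)^-1 <= kappa k (1 + t ^+ 2).
Proof.
move=> tk t0 tk2.
pose X := q ^+ (2 * k); have X1 : 1 <= X by exact: qX_ge1.
have T0 : 0 < 1 + t ^+ 2 by rewrite ltr_wpDr ?sqr_ge0.
have Q1 : 1 <= q ^+ 2 by exact: qX_ge1.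
have T1 : 1 + t ^+ 2 <= 2 * q ^+ 4 * X.
  have : t ^+ 2 <= q ^+ 4 * X.
    have -> : q ^+ 4 * X = (q ^+ k.+2) ^+ 2.
      by rewrite -exprM -exprD; congr (_ ^+ _); lia.
    by rewrite ler_sqr ?nnegrE// exprn_ge0// ltW.
  have : 1 <= q ^+ 4 * X by apply: mulr_ege1 => //; exact: qX_ge1.
  by lra.
have T2 : X <= q ^+ 2 * (1 + t ^+ 2).
  case: k tk tk2 @X X1 T1 => [|k] tk tk2 X X1 T1.
    rewrite /X muln0 expr0; apply: mulr_ege1 => //.
    by rewrite lerDl sqr_ge0.
  have -> : X = q ^+ 2 * (q ^+ k) ^+ 2.
    by rewrite /X -exprM -exprD; congr (_ ^+ _); lia.
  rewrite ler_pM2l ?exprn_gt0//.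
  have : (q ^+ k) ^+ 2 <= t ^+ 2.
    by rewrite ler_sqr ?nnegrE ?exprn_ge0 ?tk// ltW.
  by lra.
rewrite /kappa -/X; move: (1 + t ^+ 2) T0 T1 T2 => T T0 T1 T2.
have q40 : 0 < q ^+ 4 by rewrite exprn_gt0.
have q2p : 0 < 1 + q ^+ 2 by lra.
have q20 : 0 < (1 + q ^+ 2) ^+ 2 by rewrite exprn_gt0.
rewrite ler_pdivlMr ?exprn_gt0 ?addr_gt0// ?(lt_le_trans ltr01)//.
rewrite mulrC ler_pdivrMr ?mulr_gt0//.
apply: (@le_trans _ _ (((1 + q ^+ 2) * T) ^+ 2)).
  have TX0 : 0 <= T + X by lra.
  have QT0 : 0 <= (1 + q ^+ 2) * T by apply: mulr_ge0; lra.
  rewrite ler_sqr ?nnegrE ?TX0 ?QT0//; lra.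
rewrite exprMn mulrC [leRHS](_ : _ = (T * (2 * q ^+ 4 * X)) * (1 + q ^+ 2) ^+ 2); last by ring.
by rewrite ler_wpM2r ?sqr_ge0// expr2 ler_wpM2l// ltW.
Qed.

(* Of size about 1 on the [k]-th ring [q ^ k <= |z| <= q ^ (k + 1)] of the upper
   half-plane and decaying geometrically away from it; the zero [- i] and the
   double pole [- i q ^ k] lie in the lower half-plane. *)
Definition localizer k (z : R[i]) : R[i] :=
  (q ^+ k)%:C * (z + 'i) * ((z + (q ^+ k)%:C * 'i)^-1) ^+ 2.

Lemma sqr_cabs_localizer k x y : cabs (localizer k (x +i* y)) ^+ 2 =
  q ^+ (2 * k) * (x ^+ 2 + (y + 1) ^+ 2) / (x ^+ 2 + (y + q ^+ k) ^+ 2) ^+ 2.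
Proof.
rewrite /localizer cabsM cabsX cabsM cabsV !exprMn.
rewrite cabs_real real_normK ?num_real// -exprM mulnC; congr (_ * _ * _).
  by rewrite sqr_cabs/=; congr (_ ^+ 2 + _ ^+ 2); ring.
rewrite -expr2 !exprVn sqr_cabs/=; congr ((_ ^+ 2)^-1).
by congr (_ ^+ 2 + _ ^+ 2); ring.
Qed.

Lemma localizer_real_le k x :
  cabs (localizer k (x +i* 0)) ^+ 2 <= 4 * kappa k (1 + x ^+ 2).
Proof.
rewrite sqr_cabs_localizer !add0r expr1n -exprM [(k * 2)%N]mulnC /kappa.
have X1 : 1 <= q ^+ (2 * k) by exact: qX_ge1.
move: (q ^+ (2 * k)) X1 => X X1; have x0 := sqr_ge0 x.
have h : (1 + x ^+ 2 + X) ^+ 2 <= 4 * (x ^+ 2 + X) ^+ 2.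
  have -> : 4 * (x ^+ 2 + X) ^+ 2 = (2 * (x ^+ 2 + X)) ^+ 2 by ring.
  rewrite ler_sqr ?nnegrE; lra.
rewrite [x ^+ 2 + 1]addrC mulrCA ler_wpM2l//.
  by apply: mulr_ge0; lra.
rewrite ler_pdivlMr ?exprn_gt0//; last lra.
by rewrite mulrC ler_pdivrMr ?exprn_gt0//; lra.
Qed.

(** Provides the decay in [y] assumed in the Fejer-Riesz section. The growing factor [q^(2k)] is
    harmless, because the conclusion of [fejer_riesz] does not contain [M]. *)
Lemma localizer_upper_le k x y : 0 <= y ->
  cabs (localizer k (x +i* y)) ^+ 2 <= q ^+ (2 * k) / (1 + y ^+ 2).
Proof.
move=> y0; rewrite sqr_cabs_localizer -mulrA ler_wpM2l//.
  exact: le_trans ler01 (qX_ge1 _).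
have X1 : 1 <= q ^+ k by exact: qX_ge1.
move: (q ^+ k) X1 => X X1; have x0 := sqr_ge0 x.
have h1 : (y + 1) ^+ 2 <= (y + X) ^+ 2 by rewrite ler_sqr ?nnegrE; lra.
have h2 : 1 + y ^+ 2 <= (y + 1) ^+ 2 by rewrite sqrrD; lra.
have h3 : 0 <= y ^+ 2 by exact: sqr_ge0.
rewrite ler_pdivrMr ?exprn_gt0//; last lra.
rewrite mulrC ler_pdivlMr//; last lra.
rewrite [leRHS]expr2; apply: ler_pM; lra.
Qed.

Lemma localizer_ring_ge k x y : 0 <= y ->
  ((0 < k)%N -> q ^+ k <= cabs (x +i* y)) -> cabs (x +i* y) <= q ^+ k.+1 ->
  ((q + 1) ^+ 4)^-1 <= cabs (localizer k (x +i* y)) ^+ 2.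
Proof.
move=> y0 zk zk1; rewrite sqr_cabs_localizer.
pose t := cabs (x +i* y); have t0 : 0 <= t by exact: cabs_ge0.
have t2 : t ^+ 2 = x ^+ 2 + y ^+ 2 by rewrite sqr_cabs.
have yt : y <= t by apply: le_trans (ler_norm _) (ler_Im_cabs (x +i* y)).
have X1 : 1 <= q ^+ k by exact: qX_ge1.
(* For [k = 0] the point may be near the origin, and the shift by 1 provides the bound. *)
have num_ge : q ^+ (2 * k) <= x ^+ 2 + (y + 1) ^+ 2.
  have : q ^+ (2 * k) <= 1 \/ q ^+ (2 * k) <= t ^+ 2.
    case: k zk {zk1 X1} => [|k] zk; first by left; rewrite muln0.
    right; have qk0 : 0 <= q ^+ k.+1 by rewrite exprn_ge0// ltW.
    by rewrite mulnC exprM ler_sqr ?nnegrE ?qk0 ?t0// zk.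
  have := sqr_ge0 x; have := sqr_ge0 y; rewrite t2 sqrrD; case; lra.
have den_le : x ^+ 2 + (y + q ^+ k) ^+ 2 <= q ^+ (2 * k) * (q + 1) ^+ 2.
  have -> : q ^+ (2 * k) * (q + 1) ^+ 2 = (q ^+ k.+1 + q ^+ k) ^+ 2.
    by rewrite mulnC exprM (exprS q k); ring.
  apply: (@le_trans _ _ ((t + q ^+ k) ^+ 2)).
    have := ler_wpM2r (le_trans ler01 X1) yt; rewrite !sqrrD t2; lra.
  by rewrite ler_sqr ?nnegrE ?addr_ge0 ?exprn_ge0 ?lerD2r// ltW.
have den0 : 0 < x ^+ 2 + (y + q ^+ k) ^+ 2.
  by rewrite ltr_wpDl ?sqr_ge0// exprn_gt0// ltr_wpDl// (lt_le_trans ltr01).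
have q10 : 0 < q + 1 by rewrite addr_gt0.
rewrite ler_pdivlMr ?exprn_gt0// mulrC ler_pdivrMr ?exprn_gt0//.
apply: (@le_trans _ _ ((q ^+ (2 * k) * (q + 1) ^+ 2) ^+ 2)).
  by rewrite ler_sqr ?nnegrE ?mulr_ge0 ?exprn_ge0// ?ltW.
rewrite [leLHS](_ : _ = q ^+ (2 * k) * q ^+ (2 * k) * (q + 1) ^+ 4); last by ring.
apply: ler_wpM2r; first by rewrite exprn_ge0// ltW.
by apply: ler_wpM2l => //; rewrite exprn_ge0// ltW.
Qed.

Lemma localizer_cdiff k z : 0 <= complex.Im z -> cdiff (localizer k) z.
Proof.
move=> z0; apply: cdiffM; first apply: cdiffM; first exact: cdiff_cst.
  by apply: cdiffD; [exact: cdiff_id|exact: cdiff_cst].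
apply: cdiffX; apply: cdiffV.
  case: z z0 => x y /= y0; rewrite eq_complex/= negb_and; apply/orP; right.
  by rewrite mul0r mulr1 addr0 gt_eqF// ltr_wpDl// exprn_gt0.
by apply: cdiffD; [exact: cdiff_id|exact: cdiff_cst].
Qed.

End localizers.

(** * Exchanging sums over rings and integrals *)

Section integral_series.
Context d (T : measurableType d) {R : realType} (nu : {measure set T -> \bar R}).

Lemma integral_le_series (g : T -> \bar R) (a : nat -> T -> \bar R) :
  (forall x, 0 <= g x)%E -> (forall n, measurable_fun setT (a n)) ->
  (forall n x, 0 <= a n x)%E -> (forall x, exists n, g x <= a n x)%E ->
  (\int[nu]_x g x <= \sum_(n <oo) \int[nu]_x a n x)%E.
Proof.
move=> g0 ma a0 ga; rewrite -integral_nneseries//.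
apply: le_integral_nonneg => // x _; have [n gn] := ga x; apply: le_trans gn _.
apply: le_trans (nneseries_lim_ge n.+1 _); last by move=> *; exact: a0.
by rewrite big_nat_recr//= leeDr// sume_ge0.
Qed.

Lemma series_integral_le (g : T -> R) (b : nat -> T -> R) (K : R) :
  measurable_fun setT g -> (forall x, 0 <= g x) ->
  (forall n, measurable_fun setT (b n)) -> (forall n x, 0 <= b n x) ->
  (forall N x, \sum_(n < N) b n x <= K) ->
  (\sum_(n <oo) \int[nu]_x (b n x * g x)%:E <= K%:E * \int[nu]_x (g x)%:E)%E.
Proof.
move=> mg g0 mb b0 bK.
(* The sign of [K] is read off at a point of [T]; on an empty type every integral vanishes. *)
case: (pselect (inhabited T)) => [[x0]|noT]; last first.
  rewrite eseries0; last first.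
    by move=> n _ _; apply: integral0_eq => x; case: noT.
  rewrite integral0_eq ?mule0// => x; by case: noT.
have K0 : 0 <= K by have := bK 0%N x0; rewrite big_ord0.
rewrite -integral_nneseries//; last 2 first.
- by move=> n; apply/measurable_EFinP; exact: measurable_funM.
- by move=> n x _; rewrite lee_fin mulr_ge0.
rewrite -ge0_integralZl//; last 2 first.
- exact/measurable_EFinP.
- by move=> x _; rewrite lee_fin.
apply: le_integral_nonneg => x _.
  by apply: nneseries_ge0 => n _ _; rewrite lee_fin mulr_ge0.
apply: lime_le.
  by apply: is_cvg_nneseries => n _ _; rewrite lee_fin mulr_ge0.
apply: nearW => N; rewrite sumEFin -EFinM lee_fin -mulr_suml.
by rewrite big_mkord ler_wpM2r.
Qed.

End integral_series.

(** * Continuity in the plane and passage to the real line *)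

Section plane_functions.
Context {R : realType}.
Local Notation mu := (@lebesgue_measure R).
Implicit Types (f : R[i] -> R[i]) (W : R -> R -> R).

Lemma cabs_plane_continuous_at f x y : cdiff f (x +i* y) ->
  {for (x, y), continuous (fun p : R * R => cabs (f (p.1 +i* p.2)))}.
Proof.
move=> /cdiff_continuous fz; apply/cvgrPdist_le => /= e e0.
have [d d0 fd] := fz _ e0.
have d2 : 0 < d / 2 by rewrite divr_gt0.
exists (ball x (d / 2), ball y (d / 2)).
  by split; exact: nbhsx_ballx.
move=> [u v] [/= xu yv].
have := fd ((u - x) +i* (v - y)).
rewrite [in X in f X - _](_ : _ + _ = u +i* v); last first.
  by congr Complex => /=; ring.
have wd : cabs ((u - x) +i* (v - y)) < d.
  apply: (le_lt_trans (cabs_le_ReIm _)) => /=.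
  by move: xu yv; rewrite /ball/= ![`|_ - u|]distrC ![`|_ - v|]distrC; lra.
move=> /(_ wd); apply: le_trans.
have := cabsD (f (u +i* v) - f (x +i* y)) (f (x +i* y)).
have := cabsD (f (x +i* y) - f (u +i* v)) (f (u +i* v)).
rewrite !subrK -[cabs (f (x +i* y) - _)]cabsN opprB ler_norml.
by move=> ? ?; apply/andP; split; lra.
Qed.

Lemma cdiff_line_continuous f y : (forall x, cdiff f (x +i* y)) ->
  continuous (fun x => cabs (f (x +i* y)) ^+ 2).
Proof.
move=> fd x; apply: (cvg_comp (fun t : R => cabs (f (t +i* y))) (fun t : R => t ^+ 2)).
  apply: (cvg_comp (fun t : R => (t, y)) (fun p : R * R => cabs (f (p.1 +i* p.2))) _
    (cabs_plane_continuous_at (fd x))).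
  by apply: (cvg_pair (G := nbhs x) (H := nbhs y)); [exact: cvg_id|exact: cvg_cst].
exact: exprn_continuous.
Qed.

Lemma cdiff_plane_continuous f : (forall z, cdiff f z) ->
  plane_continuous (fun x y => cabs (f (x +i* y)) ^+ 2).
Proof.
move=> fd [x y]; apply: (cvg_comp (fun p : R * R => cabs (f (p.1 +i* p.2)))
  (fun t : R => t ^+ 2) (cabs_plane_continuous_at (fd _))).
exact: exprn_continuous.
Qed.

(** [Num.max y 0] continues the boundary values constantly below the real axis; this gives the
    globally continuous [W] required by the reflection and Fejer-Riesz inequalities. *)
Lemma upper_half_plane_continuous f :
  (forall z, 0 <= complex.Im z -> cdiff f z) ->
  plane_continuous (fun x y => cabs (f (x +i* Num.max y 0)) ^+ 2).
Proof.
move=> fd [x y].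
have fxy : cdiff f (x +i* Num.max y 0).
  by apply: fd; rewrite [complex.Im _]/= le_max lexx orbT.
apply: (cvg_comp (fun p : R * R => (p.1, Num.max p.2 0))
  (fun p : R * R => cabs (f (p.1 +i* p.2)) ^+ 2)); last first.
  apply: (cvg_comp (fun p : R * R => cabs (f (p.1 +i* p.2)))
    (fun t : R => t ^+ 2) (cabs_plane_continuous_at fxy)).
  exact: exprn_continuous.
apply: (cvg_pair (G := nbhs x) (H := nbhs (Num.max y 0))); first exact: cvg_fst.
have cmax : {for y, continuous (fun t : R => Num.max t 0)}.
  by apply: (@continuous_max R R id (fun=> 0)); [exact: cvg_id|exact: cvg_cst].
by apply: (cvg_comp (fun p : R * R => p.2) (fun t : R => Num.max t 0) _ cmax);
  exact: cvg_snd.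
Qed.

Lemma fatou_boundary W (M : R) : plane_continuous W -> (forall x y, 0 <= W x y) ->
  (forall y, 0 < y -> (\int[mu]_x (W x y)%:E <= M%:E)%E) ->
  (\int[mu]_x (W x 0)%:E <= M%:E)%E.
Proof.
move=> cW W0 WM.
pose f (n : nat) x := (W x n.+1%:R^-1)%:E.
have fcvg x : f ^~ x @ \oo --> (W x 0)%:E.
  apply: cvg_EFin; first exact: nearW.
  apply: (cvg_comp (fun n : nat => n.+1%:R^-1) (W x)).
    exact: cvg_harmonic.
  exact: plane_continuousr.
have -> : (\int[mu]_x (W x 0)%:E = \int[mu]_x limn_einf (f ^~ x))%E.
  by apply: eq_integral => x _; rewrite (cvg_limn_einf_sup (fcvg x)).1.
apply: le_trans (fatou _ _ _ _) _ => //.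
- move=> n; apply/measurable_EFinP; apply: continuous_measurable_fun.
  exact: plane_continuousl.
- by move=> n x _; rewrite lee_fin.
rewrite limn_einf_lim; apply: lime_le; first exact: is_cvg_einfs.
apply: nearW => n; have n0 : 0 < n.+1%:R^-1 :> R by rewrite invr_gt0.
apply: le_trans (WM _ n0).
by apply: ereal_inf_lbound; exists n => /=.
Qed.

End plane_functions.

(** * From the de Branges space to the Fock space *)

Section upper_half_plane_bound.
Context {R : realType}.
Local Notation mu := (@lebesgue_measure R).
Local Notation mu2 := (mu \x mu)%E.
Variables (alpha : R) (f : R[i] -> R[i]) (M : R).
Hypothesis alpha_gt0 : 0 < alpha.
Hypothesis fd : forall z, cdiff f z.
Local Notation q := (ratio alpha).
Local Notation G := (genfun alpha).

Hypothesis fM : forall y, 0 < y ->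
  (\int[mu]_x (cabs (f (x +i* y) / G (x +i* y)) ^+ 2)%:E <= M%:E)%E.

Let q1 : 1 < q. Proof. exact: ratio_gt1. Qed.

Let q_gt0 : 0 < q. Proof. exact: lt_trans ltr01 q1. Qed.

Definition fock_density (g : R[i] -> R[i]) (p : R * R) : R :=
  cabs (g (p.1 +i* p.2)) ^+ 2 * expR (- (2 * weight alpha (p.1 +i* p.2))).

Lemma fock_density_ge0 g p : 0 <= fock_density g p.
Proof. by rewrite mulr_ge0 ?sqr_ge0// expR_ge0. Qed.

Lemma measurable_fock_density g : (forall z, cdiff g z) ->
  measurable_fun setT (fock_density g).
Proof.
move=> gd; apply: measurable_funM.
  exact: continuous_plane_measurable (cdiff_plane_continuous gd).
apply: measurableT_comp => //; apply: measurable_funN; apply: measurable_funM => //.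
apply: measurable_funM => //; apply: measurable_funX; apply: measurable_maxr => //.
apply: measurableT_comp => //; apply: continuous_plane_measurable => p.
by case: p => x y; apply: (cabs_plane_continuous_at (cdiff_id _)).
Qed.

Let h z := f z / G z.

Let hd z : 0 <= complex.Im z -> cdiff h z.
Proof.
move=> z0; apply: cdiffM => //; apply: cdiffV.
  exact: canonical_product_neq0 q1 (genfun_cvg alpha_gt0) _ z0.
exact: canonical_product_cdiff q1 (genfun_cvg alpha_gt0) _ z0.
Qed.

Let Wh x y := cabs (h (x +i* Num.max y 0)) ^+ 2.

Let cWh : plane_continuous Wh.
Proof. exact: upper_half_plane_continuous. Qed.

Let Wh0 x y : 0 <= Wh x y. Proof. exact: sqr_ge0. Qed.

Let WhE x y : 0 <= y -> Wh x y = cabs (h (x +i* y)) ^+ 2.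
Proof. by move=> y0; rewrite /Wh max_l. Qed.

Let WhM y : 0 <= y -> (\int[mu]_x (Wh x y)%:E <= M%:E)%E.
Proof.
have WhM' t : 0 < t -> (\int[mu]_x (Wh x t)%:E <= M%:E)%E.
  move=> t0; apply: le_trans (fM t0); rewrite le_eqVlt; apply/orP; left; apply/eqP.
  by apply: eq_integral => x _; rewrite WhE// ltW.
rewrite le_eqVlt => /predU1P[<-|]; last exact: WhM'.
exact: fatou_boundary.
Qed.

Let M0 : 0 <= M.
Proof.
rewrite -lee_fin; apply: le_trans (WhM (lexx 0)).
by apply: integral_ge0 => x _; rewrite lee_fin.
Qed.

Let F k z := h z * localizer q k z.

Let W k x y := cabs (F k (x +i* Num.max y 0)) ^+ 2.

Let cW k : plane_continuous (W k).
Proof.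
apply: upper_half_plane_continuous => z z0.
by apply: cdiffM; [exact: hd|exact: localizer_cdiff].
Qed.

Let W0 k x y : 0 <= W k x y. Proof. exact: sqr_ge0. Qed.

Let WE k x y : 0 <= y ->
  W k x y = cabs (localizer q k (x +i* y)) ^+ 2 * Wh x y.
Proof. by move=> y0; rewrite /W max_l// cabsM exprMn WhE// mulrC. Qed.

Let mWh y : measurable_fun setT (fun x => Wh x y).
Proof. by apply: continuous_measurable_fun; exact: plane_continuousl. Qed.

Let W_fejer_riesz k a Y : 0 <= Y ->
  (\int[mu]_(y in `[0%R, Y]) (W k a y)%:E <= \int[mu]_x (W k x 0%R)%:E)%E.
Proof.
apply: (fejer_riesz (F := F k) (M := q ^+ (2 * k) * M)) => //.
- move=> x y y0; apply: cdiffM; first exact: hd.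
  exact: localizer_cdiff.
- by move=> x y y0; rewrite /W max_l.
- by rewrite mulr_ge0// exprn_ge0// ltW.
move=> y y0.
apply: (@le_trans _ _ (\int[mu]_x ((q ^+ (2 * k) / (1 + y ^+ 2))%:E * (Wh x y)%:E))%E).
  apply: le_integral_nonneg => x _; first by rewrite lee_fin.
  by rewrite -EFinM lee_fin WE// ler_wpM2r// localizer_upper_le.
have c0 : 0 <= q ^+ (2 * k) / (1 + y ^+ 2).
  by rewrite divr_ge0 ?exprn_ge0 ?addr_ge0 ?sqr_ge0// ltW.
rewrite ge0_integralZl_EFin//.
- rewrite (mulrAC _ M) [leRHS]EFinM; apply: lee_wpmul2l; first by rewrite lee_fin.
  exact: WhM.
- by move=> x _; rewrite lee_fin.
- by apply/measurable_EFinP; exact: mWh.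
Qed.

Let C0 := expR (q / (q - 1)) ^+ 2.

(** [|G|^2] brings [q^(- k (k + 1))] and the peak of the weight [q^(k^2)], leaving [q^(- k)]. The
    localizer is then inserted at the cost of [(q + 1)^4]. *)
Let density_le k x y : 0 <= y -> ((0 < k)%N -> q ^+ k <= cabs (x +i* y)) ->
  cabs (x +i* y) <= q ^+ k.+1 ->
  fock_density f (x, y) <= C0 ^+ 2 * q^-1 ^+ k * (q + 1) ^+ 4 * W k x y.
Proof.
move=> y0 zk zk1; rewrite /fock_density /=; set z := x +i* y.
have z0 : 0 <= complex.Im z by [].
have Gz := canonical_product_le q1 (genfun_cvg alpha_gt0) z0 zk zk1.
have Gn0 : G z != 0 by exact: canonical_product_neq0 q1 (genfun_cvg alpha_gt0) _ z0.
have -> : f z = h z * G z by rewrite /h divfK.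
rewrite cabsM exprMn WE// WhE// -/z.
have loc := localizer_ring_ge q1 y0 zk zk1; rewrite -/z in loc.
have q14 : 0 < (q + 1) ^+ 4 by rewrite exprn_gt0// addr_gt0.
have {}loc : 1 <= (q + 1) ^+ 4 * cabs (localizer q k z) ^+ 2.
  by rewrite -ler_pdivrMl// mulr1.
have G2 : cabs (G z) ^+ 2 * expR (- (2 * weight alpha z)) <= C0 ^+ 2 * q^-1 ^+ k.
  apply: (@le_trans _ _ (C0 ^+ 2 * (q ^+ (k * k.+1))^-1 *
      (cabs z ^+ (2 * k) * expR (- (2 * weight alpha z))))).
    rewrite mulrA; apply: ler_wpM2r; first exact: expR_ge0.
    rewrite -sqr_prod_geometric//; set D := \prod_(n < k) _ in Gz *.
    rewrite [leRHS](_ : _ = (C0 * (cabs z ^+ k * D)) ^+ 2); last first.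
      by rewrite mulnC exprM; ring.
    have Gz0 : 0 <= C0 * (cabs z ^+ k * D) by apply: le_trans (cabs_ge0 _) Gz.
    by rewrite ler_sqr ?nnegrE ?cabs_ge0.
  apply: le_trans (ler_wpM2l _ (weight_peak alpha_gt0 k z)) _.
    by rewrite mulr_ge0 ?sqr_ge0// invr_ge0 exprn_ge0// ltW.
  rewrite -mulrA; apply: ler_wpM2l; first exact: sqr_ge0.
  rewrite mulnS exprD invfM mulfVK ?gt_eqF ?exprn_gt0//.
  by rewrite exprVn.
apply: (@le_trans _ _ (cabs (h z) ^+ 2 * (C0 ^+ 2 * q^-1 ^+ k))).
  by rewrite -[leLHS]mulrA; apply: ler_wpM2l => //; exact: sqr_ge0.
rewrite [leRHS](_ : _ = (cabs (h z) ^+ 2 * (C0 ^+ 2 * q^-1 ^+ k)) *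
   ((q + 1) ^+ 4 * cabs (localizer q k z) ^+ 2)); last by ring.
rewrite ler_peMr// mulr_ge0 ?sqr_ge0// mulr_ge0 ?sqr_ge0// exprn_ge0//.
by rewrite invr_ge0 ltW.
Qed.

(** The first group is the cost of a single ring, the second bounds the sum of the squared
    localizers on the real line. *)
Definition upper_bound_cst : R :=
  (2 * q * C0 ^+ 2 * (q + 1) ^+ 4) * (4 * (q ^+ 2 / (q ^+ 2 - 1))).

Lemma upper_bound_cst_ge0 : 0 <= upper_bound_cst.
Proof.
have q0 := ltW q_gt0; have qs : 0 <= q ^+ 2 - 1 by rewrite subr_ge0 exprn_ege1// ltW.
apply: mulr_ge0; last by rewrite mulr_ge0 ?divr_ge0 ?sqr_ge0.
apply: mulr_ge0; last by rewrite exprn_ge0// addr_ge0.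
by apply: mulr_ge0; [exact: mulr_ge0|exact: sqr_ge0].
Qed.

Let I k : set R := `[- q ^+ k.+1, q ^+ k.+1].
Let J k : set R := `[0, q ^+ k.+1].
Let c k := C0 ^+ 2 * q^-1 ^+ k * (q + 1) ^+ 4.
Let a k := (fun p : R * R => (c k * W k p.1 p.2)%:E) \_ (I k `*` J k).

Let c0 k : 0 <= c k.
Proof.
apply: mulr_ge0; last by rewrite exprn_ge0// addr_ge0// ltW.
by apply: mulr_ge0; [exact: sqr_ge0|rewrite exprn_ge0// invr_ge0 ltW].
Qed.

Let mcW k : measurable_fun setT (fun p : R * R => (c k * W k p.1 p.2)%:E).
Proof.
apply/measurable_EFinP; apply: measurable_funM; first exact: measurable_cst.
exact: continuous_plane_measurable (@cW k).
Qed.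

Let mIJ k : measurable (I k `*` J k : set (R * R)).
Proof. by apply: measurableX; exact: measurable_itv. Qed.

Let ma k : measurable_fun setT (a k).
Proof.
by apply/(measurable_restrictT _ _).1 => //; exact: measurable_funTS (mcW k).
Qed.

Let a0 k p : (0 <= a k p)%E.
Proof. by apply: erestrict_ge0 => p' _; rewrite lee_fin mulr_ge0. Qed.

(** Fejer-Riesz bounds every vertical slice by the same real-line integral; the width [2 q^(k+1)] of
    [I k] then cancels the [q^(- k)] in [c k], so the constant is independent of [k]. *)
Let integral_a k : (\int[mu2]_p a k p <=
  \int[mu]_x ((2 * q * C0 ^+ 2 * (q + 1) ^+ 4 *
     cabs (localizer q k (x +i* 0)) ^+ 2) * Wh x 0%R)%:E)%E.
Proof.
rewrite /a -integral_mkcond integral_rect_xy//; last 3 first.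
- exact: measurable_itv.
- exact: measurable_itv.
- by move=> p; rewrite lee_fin mulr_ge0.
pose B := (\int[mu]_x (W k x 0%R)%:E)%E.
have qk : 0 < q ^+ k.+1 by rewrite exprn_gt0.
apply: (@le_trans _ _ (\int[mu]_(x in I k) cst ((c k)%:E * B) x)%E).
  apply: le_integral_nonneg => x _.
    by apply: integral_ge0 => y _; rewrite lee_fin mulr_ge0.
  under eq_integral do rewrite EFinM.
  rewrite ge0_integralZl_EFin//.
  - apply: lee_wpmul2l; first by rewrite lee_fin.
    by apply: W_fejer_riesz; exact: ltW.
  - exact: measurable_itv.
  - by move=> y _; rewrite lee_fin.
  apply/measurable_EFinP; apply: measurable_funTS.
  apply: continuous_measurable_fun; apply: plane_continuousr.
  exact: (@cW k).
rewrite integral_cst//; last exact: measurable_itv.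
have muI : mu (I k) = (2 * q ^+ k.+1)%:E.
  by rewrite lebesgue_segment; [congr EFin; ring|lra].
rewrite [X in (_ * X <= _)%E]muI.
rewrite le_eqVlt; apply/orP; left; apply/eqP.
rewrite muleC muleA -EFinM /B -ge0_integralZl_EFin//; last 3 first.
- by move=> x _; rewrite lee_fin.
- apply/measurable_EFinP; apply: continuous_measurable_fun.
  exact: plane_continuousl.
- by rewrite mulr_ge0// mulr_ge0// ltW.
apply: eq_integral => x _; rewrite -EFinM WE// mulrA; congr (_ * _ * _)%:E.
rewrite /c exprVn exprS; field; rewrite gt_eqF// exprn_gt0//.
Qed.

Lemma boundary_norm_le :
  (\int[mu]_x (cabs (f (x +i* 0) / G (x +i* 0)) ^+ 2)%:E <= M%:E)%E.
Proof.
apply: le_trans (WhM (lexx 0)); rewrite le_eqVlt; apply/orP; left; apply/eqP.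
by apply: eq_integral => x _; rewrite WhE.
Qed.

Lemma upper_half_plane_bound :
  (\int[mu2]_(p in setT `*` `[0%R, +oo[) (fock_density f p)%:E <=
   upper_bound_cst%:E *
     \int[mu]_x (cabs (f (x +i* 0) / G (x +i* 0)) ^+ 2)%:E)%E.
Proof.
have -> : (\int[mu]_x (cabs (f (x +i* 0) / G (x +i* 0)) ^+ 2)%:E =
    \int[mu]_x (Wh x 0%R)%:E)%E.
  by apply: eq_integral => x _; rewrite WhE.
rewrite [leLHS]integral_mkcond.
set E := (_ \_ _ : R * R -> \bar R).
have E0 p : (0 <= E p)%E.
  by apply: erestrict_ge0 => p' _; exact: fock_density_ge0.
have Ea p : exists k, (E p <= a k p)%E.
  case: p => x y; have [k [zk zk1]] := ring_index alpha_gt0 (x +i* y); exists k.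
  rewrite /E {1}/patch; case: ifPn => [|_]; last exact: a0.
  rewrite in_setX => /andP[_]; rewrite inE/= in_itv/= andbT => y0.
  rewrite /a /patch ifT.
    by rewrite lee_fin; exact: density_le.
  have := le_trans (ler_Re_cabs _) zk1; have := le_trans (ler_Im_cabs _) zk1.
  rewrite /= !ler_norml => /andP[_ yq] /andP[qx xq].
  by rewrite in_setX; apply/andP; split; rewrite inE /I /J /= in_itv/=; apply/andP.
have h1 := integral_le_series mu2 E0 (@ma) a0 Ea.
apply: le_trans h1 _.
apply: le_trans (lee_nneseries _ _) _.
- by move=> k _ _; apply: integral_ge0 => p _; exact: a0.
- by move=> k _; exact: integral_a.
apply: series_integral_le.
- exact: mWh.
- by move=> x; exact: Wh0.
- move=> k; apply: measurable_funM; first exact: measurable_cst.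
  apply: continuous_measurable_fun; apply: cdiff_line_continuous => x.
  exact: localizer_cdiff.
- move=> k x; rewrite mulr_ge0 ?sqr_ge0// !mulr_ge0 ?sqr_ge0 ?exprn_ge0 ?addr_ge0// ltW//.
move=> N x; rewrite -mulr_sumr /upper_bound_cst ler_wpM2l//.
  by rewrite !mulr_ge0 ?sqr_ge0 ?exprn_ge0 ?addr_ge0// ltW.
apply: (@le_trans _ _ (\sum_(k < N) 4 * kappa q k (1 + x ^+ 2))).
  by apply: ler_sum => k _; exact: localizer_real_le.
by rewrite -mulr_sumr ler_wpM2l// sum_kappa_le// ltr_wpDr ?sqr_ge0.
Qed.

End upper_half_plane_bound.

(** * From the Fock space to the de Branges space *)

Section horizontal_line_bound.
Context {R : realType}.
Local Notation mu := (@lebesgue_measure R).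
Local Notation mu2 := (mu \x mu)%E.
Variables (alpha : R) (f : R[i] -> R[i]).
Hypothesis alpha_gt0 : 0 < alpha.
Hypothesis fd : forall z, cdiff f z.
Local Notation q := (ratio alpha).
Local Notation G := (genfun alpha).

Let q1 : 1 < q. Proof. exact: ratio_gt1. Qed.

Let q_gt0 : 0 < q. Proof. exact: lt_trans ltr01 q1. Qed.

(** Small enough that a rectangle of margin [q^k * eta] around a segment of the [k]-th ring stays
    between the radii [q^(k-1)] and [q^(k+2)]. *)
Let eta := (1 - q^-1) / 4.

Let eta_gt0 : 0 < eta.
Proof. by rewrite divr_gt0// subr_gt0 invf_lt1. Qed.

(** [4 / eta] comes from the trace inequality, [q ^+ 4] from [weight_near_peak], and the last factor
    is the inverse of the lower bound in [kappa_ring_ge]. *)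
Let K1 := 4 / eta * q ^+ 4 * (2 * q ^+ 4 * (1 + q ^+ 2) ^+ 2).

Let K1_ge0 : 0 <= K1.
Proof.
have e0 := ltW eta_gt0; have qx n : 0 <= q ^+ n by rewrite exprn_ge0// ltW.
rewrite /K1; apply: mulr_ge0; apply: mulr_ge0 => //; first exact: divr_ge0.
  by apply: mulr_ge0.
exact: sqr_ge0.
Qed.

Definition line_bound_cst : R := 2 * K1 * (q ^+ 2 / (q ^+ 2 - 1)).

(** With [|y|] inside [G], one estimate serves [f / G] at positive heights and [sharp f / G], whose
    modulus at height [y] is read on the line at height [- y]. *)
Definition line_density y x : R :=
  cabs (f (x +i* y)) ^+ 2 * cabs ((G (x +i* `|y|))^-1) ^+ 2.

(** The bump [kappa] replaces the indicator of the enlarged ring: these rings overlap, but the sum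
    of the bumps is bounded by [sum_kappa_le]. *)
Let density k p : R :=
  kappa q k (1 + cabs (p.1 +i* p.2) ^+ 2) * fock_density alpha f p.

Let cabs_abs (x y : R) : cabs (x +i* `|y|) = cabs (x +i* y).
Proof. by rewrite /cabs /= real_normK ?num_real. Qed.

Let density_ge0 k p : 0 <= density k p.
Proof.
by rewrite mulr_ge0 ?fock_density_ge0// kappa_ge0// addr_ge0 ?sqr_ge0.
Qed.

Lemma measurable_kappa k : measurable_fun setT
  (fun p : R * R => kappa q k (1 + cabs (p.1 +i* p.2) ^+ 2)).
Proof.
apply: continuous_plane_measurable => p.
have cT : {for p, continuous (fun p : R * R => 1 + cabs (p.1 +i* p.2) ^+ 2)}.
  apply: cvgD; first exact: cvg_cst.
  exact: (cdiff_plane_continuous (@cdiff_id R)).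
have Q0 : 0 < q ^+ (2 * k) by rewrite exprn_gt0.
apply: cvgM; first by apply: cvgM => //; exact: cvg_cst.
apply: cvgV.
  by rewrite gt_eqF// exprn_gt0// ltr_wpDl// addr_ge0 ?sqr_ge0.
apply: (cvg_comp (fun p : R * R => 1 + cabs (p.1 +i* p.2) ^+ 2 + q ^+ (2 * k))
  (fun t : R => t ^+ 2)); last exact: exprn_continuous.
by apply: cvgD => //; exact: cvg_cst.
Qed.

Let mdens k : measurable_fun setT (density k).
Proof.
by apply: measurable_funM; [exact: measurable_kappa|exact: measurable_fock_density].
Qed.

Section segment.
Variables (k : nat) (a b y : R).
Hypothesis ab : a <= b.
Hypothesis ring_ab : forall x, a <= x <= b ->
  ((0 < k)%N -> q ^+ k <= cabs (x +i* y)) /\ cabs (x +i* y) <= q ^+ k.+1.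

Let dl := q ^+ k * eta.

Let dl_gt0 : 0 < dl. Proof. by rewrite mulr_gt0// exprn_gt0. Qed.

Let rect_ring u v : a - dl <= u <= b + dl -> y - dl <= v <= y + dl ->
  ((0 < k)%N -> q ^+ k.-1 <= cabs (u +i* v)) /\ cabs (u +i* v) <= q ^+ k.+2.
Proof.
move=> uab vy.
have [x xab ux] : exists2 x, a <= x <= b & `|u - x| <= dl.
  have [ua|au] := ltP u a.
    by exists a; rewrite ?lexx ?ab// ler_norml; have := dl_gt0; move: ua uab; lra.
  have [bu|ub] := ltP b u.
    by exists b; rewrite ?lexx ?ab// ler_norml; have := dl_gt0; move: bu uab; lra.
  by exists u; rewrite ?au ?ub// subrr normr0 ltW.
have [zk zk1] := ring_ab xab.
have dist : cabs ((u - x) +i* (v - y)) <= 2 * dl.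
  apply: le_trans (cabs_le_ReIm _) _ => /=.
  have : `|v - y| <= dl by rewrite ler_norml; move: vy; lra.
  by move: ux; lra.
have two_dl : 2 * dl <= q ^+ k * (1 - q^-1).
  have : 0 <= q ^+ k * (1 - q^-1).
    by rewrite mulr_ge0 ?exprn_ge0// ?subr_ge0 ?invf_le1// ltW.
  by rewrite /dl /eta; lra.
have uvE : u +i* v = (x +i* y) + ((u - x) +i* (v - y)).
  by apply/eqP; rewrite eq_complex/=; apply/andP; split; apply/eqP; ring.
split=> [k0|].
  have := zk k0; have : cabs (x +i* y) <= cabs (u +i* v) + 2 * dl.
    rewrite (_ : x +i* y = u +i* v - ((u - x) +i* (v - y))).
      by apply: le_trans (cabsD _ _) _; rewrite cabsN lerD2l.
    by rewrite uvE addrK.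
  have -> : q ^+ k.-1 = q ^+ k * q^-1.
    by rewrite -{2}(prednK k0) exprSr mulfK// gt_eqF.
  by move: two_dl; lra.
rewrite uvE; apply: le_trans (cabsD _ _) _.
apply: le_trans (lerD zk1 (le_trans dist two_dl)) _.
rewrite 2!exprS (exprS q k).
have X0 : 0 < q ^+ k by rewrite exprn_gt0.
have : 0 <= q ^+ k * ((q - 1) * (q - q^-1)).
  rewrite mulr_ge0 ?mulr_ge0 ?subr_ge0 ?ltW//.
  by apply: lt_trans q1; rewrite invf_lt1.
have -> : q ^+ k * ((q - 1) * (q - q^-1)) =
    q * (q * q ^+ k) - q * q ^+ k - q ^+ k * (1 - q^-1).
  by field; rewrite gt_eqF.
by lra.
Qed.

(** [|f / z^k|^2], truncated near the origin to be continuous on the plane. The maximum is inactive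
    on the rectangle when [0 < k], and for [k = 0] the exponent is 0. *)
Let V x t := cabs (f (x +i* t)) ^+ 2 *
  (Num.max (cabs (x +i* t)) (q ^+ k.-1))^-1 ^+ (2 * k).

Let V0 x t : 0 <= V x t.
Proof.
rewrite mulr_ge0 ?sqr_ge0// exprn_ge0// invr_ge0 le_max.
by rewrite cabs_ge0.
Qed.

Let cV : plane_continuous V.
Proof.
move=> [x t]; apply: cvgM; first exact: (cdiff_plane_continuous fd).
pose m : R * R -> R := fun p => Num.max (cabs (p.1 +i* p.2)) (q ^+ k.-1).
have m_gt0 p : 0 < m p by rewrite lt_max exprn_gt0// orbT.
have cm : {for (x, t), continuous m}.
  apply: continuous_max; last exact: cvg_cst.
  exact: (cabs_plane_continuous_at (cdiff_id _)).
have cmV : {for (x, t), continuous (fun p => (m p)^-1)}.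
  by apply: cvgV => //; rewrite gt_eqF.
apply: (cvg_comp (fun p => (m p)^-1) (fun s : R => s ^+ (2 * k)) cmV).
exact: exprn_continuous.
Qed.

Let mV : measurable_fun setT (fun p : R * R => V p.1 p.2).
Proof. exact: continuous_plane_measurable. Qed.

Let VE x t : ((0 < k)%N -> q ^+ k.-1 <= cabs (x +i* t)) ->
  V x t = cabs (f (x +i* t)) ^+ 2 * (cabs (x +i* t))^-1 ^+ (2 * k).
Proof.
rewrite /V; case: (posnP k) => [->|k0 h]; first by rewrite !muln0 !expr0.
by rewrite max_l// h.
Qed.

Let V_trace : (dl%:E * \int[mu]_(x in `[a, b]) (V x y)%:E <=
   4%:E * \int[mu2]_(p in `[(a - dl)%R, (b + dl)%R] `*` `[(y - dl)%R, (y + dl)%R])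
     (V p.1 p.2)%:E)%E.
Proof.
apply: (trace_horizontal (F := fun z => f z * z^-1 ^+ k)) => //; first exact: ltW.
- move=> x t xab ty; have [zk _] := rect_ring xab ty.
  apply: cdiffM => //; case: (posnP k) => [->|k0].
    rewrite (_ : (fun _ => _) = fun=> 1); first exact: cdiff_cst.
    by apply/funext => w; rewrite expr0.
  apply: cdiffX; apply: cdiffV; last exact: cdiff_id.
  by rewrite -cabs_gt0; apply: lt_le_trans (zk k0); rewrite exprn_gt0.
move=> x t xab ty; have [zk _] := rect_ring xab ty.
by rewrite VE// cabsM exprMn cabsX cabsV -[_ ^+ k ^+ 2]exprM mulnC.
Qed.

Let V_le x t : a - dl <= x <= b + dl -> y - dl <= t <= y + dl ->
  q ^+ (k * k) * V x t <=
  q ^+ 4 * (2 * q ^+ 4 * (1 + q ^+ 2) ^+ 2) * density k (x, t).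
Proof.
move=> xab ty; have [zk zk2] := rect_ring xab ty; rewrite VE//.
have := weight_near_peak alpha_gt0 zk zk2.
have := kappa_ring_ge q1 zk (cabs_ge0 _) zk2.
rewrite /density /fock_density /=; set z := x +i* t.
have Cp : 0 < 2 * q ^+ 4 * (1 + q ^+ 2) ^+ 2.
  by rewrite !mulr_gt0 ?exprn_gt0// addr_gt0 ?exprn_gt0.
move: (2 * q ^+ 4 * _) Cp => Cc Cp kap wgt.
have {}kap : 1 <= Cc * kappa q k (1 + cabs z ^+ 2) by rewrite -ler_pdivrMl// mulr1.
have q4 : 0 <= q ^+ 4 by rewrite exprn_ge0// ltW.
have e0 : 0 <= expR (- (2 * weight alpha z)) by exact: expR_ge0.
move: (kappa _ _ _) kap => kap k1; move: (expR _) e0 wgt => ex e0 wgt.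
apply: (@le_trans _ _ (q ^+ 4 * cabs (f z) ^+ 2 * ex)).
  have cz0 : 0 <= (cabs z)^-1 ^+ (2 * k) by rewrite exprn_ge0// invr_ge0 cabs_ge0.
  have := ler_wpM2l (mulr_ge0 (sqr_ge0 (cabs (f z))) cz0) wgt.
  rewrite mulrC => /le_trans; apply.
  rewrite [leLHS](_ : _ = q ^+ 4 * cabs (f z) ^+ 2 * ex *
     ((cabs z)^-1 ^+ (2 * k) * cabs z ^+ (2 * k))); last by ring.
  apply: ler_piMr; first by do 2 apply: mulr_ge0 => //; exact: sqr_ge0.
  rewrite -exprMn.
  (* At the origin [0^-1 = 0], so the product is a power of 0, which is at most 1. *)
  have [->|z0] := eqVneq (cabs z) 0; last by rewrite mulVf// expr1n.
  by rewrite mulr0 exprn_ile1// ler01.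
rewrite [leRHS](_ : _ = (Cc * kap) * (q ^+ 4 * cabs (f z) ^+ 2 * ex)); last by ring.
apply: ler_peMl => //.
by do 2 apply: mulr_ge0 => //; exact: sqr_ge0.
Qed.

Let line_le x : a <= x <= b -> line_density y x <= q ^+ (k * k.+1) * V x y.
Proof.
move=> xab; have [zk _] := ring_ab xab.
have zk' : (0 < k)%N -> q ^+ k.-1 <= cabs (x +i* y).
  move=> k0; apply: le_trans (zk k0).
  by rewrite ler_eXn2l// leq_pred.
rewrite /line_density VE// [leRHS]mulrCA ler_wpM2l ?sqr_ge0//.
have y0 : 0 <= complex.Im (x +i* `|y|) by rewrite /= normr_ge0.
have Gz := canonical_product_ge q1 (genfun_cvg alpha_gt0) k y0.
rewrite cabs_abs in Gz; rewrite cabsV exprVn exprVn.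
have Gp : 0 < cabs (G (x +i* `|y|)).
  by rewrite cabs_gt0 (canonical_product_neq0 q1 (genfun_cvg alpha_gt0)).
have [z0|z0] := eqVneq (cabs (x +i* y)) 0.
  have k0 : k = 0%N.
    case: (posnP k) => // k0; have := zk k0; rewrite z0 leNgt exprn_gt0//.
  rewrite k0 mul0n muln0 !expr0 invr1 mulr1 invf_le1 ?exprn_gt0// exprn_ege1//.
  by move: Gz; rewrite k0 big_ord0 expr0 mulr1.
have zp : 0 < cabs (x +i* y) by rewrite lt_def z0 cabs_ge0.
have qkp : 0 < q ^+ (k * k.+1) by rewrite exprn_gt0.
rewrite -[q ^+ _]invrK -invfM -(sqr_prod_geometric alpha_gt0).
rewrite lef_pV2 ?posrE ?exprn_gt0//; last first.
  rewrite mulr_gt0 ?exprn_gt0//.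
  by apply: prodr_gt0 => i _; rewrite exprn_gt0// invr_gt0.
rewrite [leLHS](_ : _ = (cabs (x +i* y) ^+ k * \prod_(n < k) q^-1 ^+ n.+1) ^+ 2).
  rewrite ler_sqr ?nnegrE// ?cabs_ge0// mulr_ge0 ?exprn_ge0 ?cabs_ge0//.
  by rewrite prodr_ge0// => i _; rewrite exprn_ge0// invr_ge0 ltW.
by rewrite mulnC exprM; ring.
Qed.

Lemma segment_bound :
  (\int[mu]_(x in `[a, b]) (line_density y x)%:E <=
   K1%:E * \int[mu2]_p (density k p)%:E)%E.
Proof.
pose P : set (R * R) := `[(a - dl)%R, (b + dl)%R] `*` `[(y - dl)%R, (y + dl)%R].
have mP : measurable P by apply: measurableX; exact: measurable_itv.
have qk0 n : 0 < q ^+ n by rewrite exprn_gt0.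
apply: (@le_trans _ _ ((q ^+ (k * k.+1))%:E * \int[mu]_(x in `[a, b]) (V x y)%:E)%E).
  rewrite -ge0_integralZl_EFin//; last 3 first.
  - by move=> x _; rewrite lee_fin.
  - apply/measurable_EFinP; apply: measurable_funTS.
    by apply: continuous_measurable_fun; exact: plane_continuousl.
  - exact: ltW.
  apply: le_integral_nonneg => x.
    by move=> _; rewrite lee_fin mulr_ge0 ?sqr_ge0.
  by rewrite /= in_itv/= => xab; rewrite -EFinM lee_fin line_le.
(* The surplus [q^k] of [q^(k (k + 1))] over [q^(k^2)] is absorbed by the margin [dl = q^k * eta] of
   the trace inequality. *)
have -> : ((q ^+ (k * k.+1))%:E * \int[mu]_(x in `[a, b]) (V x y)%:E =
    (q ^+ (k * k) / eta)%:E * (dl%:E * \int[mu]_(x in `[a, b]) (V x y)%:E))%E.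
  rewrite muleA -EFinM; congr (_%:E * _)%E; rewrite /dl mulnS exprD.
  by field; rewrite gt_eqF.
have h0 : 0 <= q ^+ (k * k) / eta by rewrite divr_ge0 ?ltW.
apply: le_trans (lee_wpmul2l _ V_trace) _; first by rewrite lee_fin.
rewrite -/P.
have -> : ((q ^+ (k * k) / eta)%:E * (4%:E * \int[mu2]_(p in P) (V p.1 p.2)%:E) =
    (4 / eta)%:E * \int[mu2]_(p in P) ((q ^+ (k * k))%:E * (V p.1 p.2)%:E))%E.
  rewrite ge0_integralZl_EFin//.
  - by rewrite !muleA -!EFinM; congr (_%:E * _)%E; ring.
  - by move=> p _; rewrite lee_fin.
  - by apply/measurable_EFinP; exact: measurable_funTS.
  - exact: ltW.
have -> : K1 = 4 / eta * (q ^+ 4 * (2 * q ^+ 4 * (1 + q ^+ 2) ^+ 2)).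
  by rewrite /K1 [RHS]mulrA.
rewrite [in leRHS]EFinM -muleA; apply: lee_wpmul2l.
  by rewrite lee_fin divr_ge0// ltW.
apply: (@le_trans _ _ (\int[mu2]_(p in P)
   (q ^+ 4 * (2 * q ^+ 4 * (1 + q ^+ 2) ^+ 2) * density k p)%:E)%E).
  apply: le_integral_nonneg => -[u v] /=.
    by move=> _; rewrite -EFinM lee_fin mulr_ge0// ltW.
  by rewrite /P /= !in_itv/= => -[uab vy]; rewrite -EFinM lee_fin V_le.
have c0 : 0 <= q ^+ 4 * (2 * q ^+ 4 * (1 + q ^+ 2) ^+ 2).
  apply: mulr_ge0; first exact: ltW.
  by apply: mulr_ge0; [apply: mulr_ge0 => //; exact: ltW|exact: sqr_ge0].
rewrite -ge0_integralZl_EFin//; last 2 first.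
- by move=> p _; rewrite lee_fin.
- by apply/measurable_EFinP; exact: (@mdens k).
under [leRHS]eq_integral do rewrite -EFinM.
apply: ge0_subset_integral => //.
- apply/measurable_EFinP; apply: measurable_funM; first exact: measurable_cst.
  exact: mdens.
- by move=> p _; rewrite lee_fin mulr_ge0.
Qed.

End segment.

Let line_density_ge0 y x : 0 <= line_density y x.
Proof. by rewrite mulr_ge0 ?sqr_ge0. Qed.

Let measurable_line_density y :
  measurable_fun setT (fun x => (line_density y x)%:E).
Proof.
apply/measurable_EFinP; apply: measurable_funM.
  by apply: continuous_measurable_fun; exact: cdiff_line_continuous.
apply: continuous_measurable_fun.
apply: (cdiff_line_continuous (f := fun z => (G z)^-1)) => x.
have y0 : 0 <= complex.Im (x +i* `|y|) by rewrite /= normr_ge0.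
apply: cdiffV; first exact: canonical_product_neq0 q1 (genfun_cvg alpha_gt0) _ y0.
exact: canonical_product_cdiff q1 (genfun_cvg alpha_gt0) _ y0.
Qed.

Section line.
Variable y : R.

(* The part [0 <= x] of the line at height [y] meets the [k]-th ring in
   [[inner k, outer k]], provided [`|y| <= q ^+ k.+1]. *)
Let inner k : R :=
  if (0 < k)%N then Num.sqrt (q ^+ (2 * k) - y ^+ 2) else 0.
Let outer k : R := Num.sqrt (q ^+ (2 * k.+1) - y ^+ 2).
(** The square root of a negative number is 0: without this test a line missing the ring would still
    be assigned the point [x = 0]. *)
Let meets k := y ^+ 2 <= q ^+ (2 * k.+1).
Let right k : set R := if meets k then `[inner k, outer k]%classic else set0.
Let left k : set R := if meets k then `[- outer k, - inner k]%classic else set0.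

Let ring_sqr k (x : R) : ((0 < k)%N -> q ^+ (2 * k) <= x ^+ 2 + y ^+ 2) ->
  x ^+ 2 + y ^+ 2 <= q ^+ (2 * k.+1) ->
  ((0 < k)%N -> q ^+ k <= cabs (x +i* y)) /\ cabs (x +i* y) <= q ^+ k.+1.
Proof.
have qx n : 0 <= q ^+ n by rewrite exprn_ge0// ltW.
move=> h1 h2; split=> [k0|].
  by rewrite -ler_sqr ?nnegrE ?cabs_ge0// sqr_cabs -exprM mulnC h1.
by rewrite -ler_sqr ?nnegrE ?cabs_ge0// sqr_cabs -exprM mulnC.
Qed.

Let inner_ge0 k : 0 <= inner k.
Proof. by rewrite /inner; case: ifP => // _; exact: sqrtr_ge0. Qed.

Let inner_le_outer k : inner k <= outer k.
Proof.
rewrite /inner; case: ifP => _; last exact: sqrtr_ge0.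
apply: ler_wsqrtr; rewrite lerB// ler_eXn2l// leq_mul2l; exact: leqnSn.
Qed.

Let right_ring k x : meets k -> inner k <= `|x| <= outer k ->
  ((0 < k)%N -> q ^+ k <= cabs (x +i* y)) /\ cabs (x +i* y) <= q ^+ k.+1.
Proof.
move=> yk /andP[ix xo]; have x2 : `|x| ^+ 2 = x ^+ 2 by rewrite real_normK ?num_real.
apply: ring_sqr => [k0|].
  (* A line passing outside the inner circle has [inner k = 0], and [y] alone gives the lower
     bound. *)
  have [yq|yq] := leP (y ^+ 2) (q ^+ (2 * k)); last first.
    by have := sqr_ge0 x; move: yq; lra.
  have : inner k ^+ 2 <= `|x| ^+ 2 by rewrite ler_sqr ?nnegrE.
  by rewrite x2 /inner k0 sqr_sqrtr ?subr_ge0//; lra.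
have : `|x| ^+ 2 <= outer k ^+ 2 by rewrite ler_sqr ?nnegrE ?sqrtr_ge0.
by rewrite x2 /outer sqr_sqrtr ?subr_ge0//; lra.
Qed.

Let mright k : measurable (right k).
Proof. by rewrite /right; case: ifP => _; [exact: measurable_itv|exact: measurable0]. Qed.

Let mleft k : measurable (left k).
Proof. by rewrite /left; case: ifP => _; [exact: measurable_itv|exact: measurable0]. Qed.

Let side_ge0 k : (0 <= K1%:E * \int[mu2]_p (density k p)%:E)%E.
Proof.
apply: mule_ge0; first by rewrite lee_fin.
by apply: integral_ge0 => p _; rewrite lee_fin.
Qed.

Let right_bound k : (\int[mu]_(x in right k) (line_density y x)%:E <=
   K1%:E * \int[mu2]_p (density k p)%:E)%E.
Proof.
rewrite /right; case: ifP => [yk|_]; last by rewrite integral_set0.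
apply: segment_bound => // x xio; apply: right_ring => //.
by rewrite ger0_norm//; have := inner_ge0 k; move: xio; lra.
Qed.

Let left_bound k : (\int[mu]_(x in left k) (line_density y x)%:E <=
   K1%:E * \int[mu2]_p (density k p)%:E)%E.
Proof.
rewrite /left; case: ifP => [yk|_]; last by rewrite integral_set0.
apply: segment_bound => [|x xio]; first by rewrite lerN2.
apply: right_ring => //; have := inner_ge0 k; move: xio => /andP[ox xi] i0.
by rewrite ler0_norm; lra.
Qed.

Let a k x := (((fun x => (line_density y x)%:E) \_ (right k)) x +
  ((fun x => (line_density y x)%:E) \_ (left k)) x)%E.

Let restr0 (A : set R) x : (0 <= ((fun x => (line_density y x)%:E) \_ A) x)%E.
Proof. by apply: erestrict_ge0 => t _; rewrite lee_fin. Qed.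

Let mrestr (A : set R) : measurable A ->
  measurable_fun setT ((fun x => (line_density y x)%:E) \_ A).
Proof.
by move=> mA; apply/(measurable_restrictT _ _).1 => //; exact: measurable_funTS.
Qed.

Let line_cover x : exists k, ((line_density y x)%:E <= a k x)%E.
Proof.
have [k [zk zk1]] := ring_index alpha_gt0 (x +i* y); exists k.
have x2 : `|x| ^+ 2 = x ^+ 2 by rewrite real_normK ?num_real.
have z2 : x ^+ 2 + y ^+ 2 <= q ^+ (2 * k.+1).
  rewrite -[X in X <= _](sqr_cabs (x +i* y)) mulnC exprM.
  by rewrite ler_sqr ?nnegrE ?cabs_ge0// exprn_ge0// ltW.
have yk : meets k by apply: le_trans z2; rewrite lerDr sqr_ge0.
have xo : `|x| <= outer k.
  rewrite -ler_sqr ?nnegrE ?sqrtr_ge0// x2 /outer sqr_sqrtr ?subr_ge0//.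
  by rewrite lerBrDr.
have ix : inner k <= `|x|.
  rewrite /inner; case: ifP => // k0.
  rewrite -sqrtr_sqr; apply: ler_wsqrtr; rewrite lerBlDr.
  rewrite -(sqr_cabs (x +i* y)) mulnC exprM ler_sqr ?nnegrE ?cabs_ge0 ?zk//.
  by rewrite exprn_ge0// ltW.
rewrite /a; have [x0|x0] := leP 0 x.
  apply: le_trans (leeDl _ (restr0 _ _)); rewrite /patch ifT//.
  rewrite inE /right yk /= in_itv/=; apply/andP.
  by move: ix xo; rewrite ger0_norm.
apply: le_trans (leeDr _ (restr0 _ _)); rewrite /patch ifT//.
rewrite inE /left yk /= in_itv/=; apply/andP.
by move: ix xo; rewrite ltr0_norm// => ? ?; split; lra.
Qed.

Lemma line_bound : (\int[mu]_x (line_density y x)%:E <=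
  line_bound_cst%:E *
  \int[mu2]_p (fock_density alpha f p)%:E)%E.
Proof.
have ma k : measurable_fun setT (a k) by apply: emeasurable_funD; exact: mrestr.
have a0 k x : (0 <= a k x)%E by apply: adde_ge0.
have g0 x : (0 <= (line_density y x)%:E)%E by rewrite lee_fin.
apply: le_trans (integral_le_series mu g0 ma a0 line_cover) _.
pose b k (p : R * R) := 2 * K1 * kappa q k (1 + cabs (p.1 +i* p.2) ^+ 2).
have kap0 k (p : R * R) : 0 <= kappa q k (1 + cabs (p.1 +i* p.2) ^+ 2).
  by rewrite kappa_ge0// addr_ge0 ?sqr_ge0.
have K20 : 0 <= 2 * K1 by exact: mulr_ge0.
have b0 k p : 0 <= b k p by exact: mulr_ge0.
apply: (@le_trans _ _
    (\sum_(k <oo) \int[mu2]_p (b k p * fock_density alpha f p)%:E)%E).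
  apply: lee_nneseries => [k _ _|k _]; first by apply: integral_ge0 => x _.
  rewrite /a ge0_integralD//; last 2 first.
  - exact: mrestr.
  - exact: mrestr.
  rewrite -!integral_mkcond.
  apply: le_trans (leeD (right_bound k) (left_bound k)) _.
  have -> : (\int[mu2]_p (b k p * fock_density alpha f p)%:E =
     (2 * K1)%:E * \int[mu2]_p (density k p)%:E)%E.
    rewrite -ge0_integralZl_EFin//.
    - by apply: eq_integral => p _; rewrite -EFinM /density /b; congr EFin; ring.
    - by move=> p _; rewrite lee_fin.
    - by apply/measurable_EFinP; exact: (@mdens k).
  rewrite mulrDl mul1r EFinD ge0_muleDl ?lee_fin//.
apply: series_integral_le => //.
- exact: measurable_fock_density.
- by move=> p; exact: fock_density_ge0.
- by move=> k; apply: measurable_funM; [exact: measurable_cst|exact: measurable_kappa].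
move=> N p; rewrite -mulr_sumr; apply: ler_wpM2l => //; apply: sum_kappa_le => //.
by rewrite ltr_wpDr ?sqr_ge0.
Qed.

End line.

End horizontal_line_bound.

(** * Equality of the two spaces *)

Section fock_versus_de_branges.
Context {R : realType}.
Local Notation mu := (@lebesgue_measure R).
Local Notation mu2 := (mu \x mu)%E.
Variable alpha : R.
Hypothesis alpha_gt0 : 0 < alpha.
Local Notation G := (genfun alpha).
Implicit Types f : R[i] -> R[i].

Definition fock_integral f : \bar R := (\int[mu2]_p (fock_density alpha f p)%:E)%E.

Definition real_line_integral f : \bar R :=
  (\int[mu]_x (cabs (f (x +i* 0) / G (x +i* 0)) ^+ 2)%:E)%E.

Lemma fock_integral_ge0 f : (0 <= fock_integral f)%E.
Proof. by apply: integral_ge0 => p _; rewrite lee_fin fock_density_ge0. Qed.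

Lemma real_line_integral_ge0 f : (0 <= real_line_integral f)%E.
Proof. by apply: integral_ge0 => x _; rewrite lee_fin sqr_ge0. Qed.

Lemma entire_cdiff f : entire f -> forall z, cdiff f z.
Proof. by move=> fe z; apply/cdiffP. Qed.

Lemma cdiff_sharp f : (forall z, cdiff f z) -> forall z, cdiff (sharp f) z.
Proof. by move=> fd z; apply: cdiff_conj. Qed.

Lemma cabs_sharp f x y : cabs (sharp f (x +i* y)) = cabs (f (x -i* y)).
Proof. by rewrite /sharp cabsJ. Qed.

Lemma fock_density_sharp f x y :
  fock_density alpha (sharp f) (x, y) = fock_density alpha f (x, - y).
Proof.
rewrite /fock_density /= cabs_sharp /weight.
by rewrite -[cabs (x +i* y)]cabsJ.
Qed.

Lemma real_line_integral_sharp f : real_line_integral (sharp f) = real_line_integral f.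
Proof.
apply: eq_integral => x _; rewrite !cabsM cabs_sharp.
by rewrite oppr0.
Qed.

Lemma fock_integral_split f : (forall z, cdiff f z) ->
  (fock_integral f <=
   \int[mu2]_(p in setT `*` `[0%R, +oo[) (fock_density alpha f p)%:E +
   \int[mu2]_(p in setT `*` `[0%R, +oo[) (fock_density alpha (sharp f) p)%:E)%E.
Proof.
move=> fd.
have md g : (forall z, cdiff g z) ->
    measurable_fun setT (fun p => (fock_density alpha g p)%:E).
  by move=> gd; apply/measurable_EFinP; exact: measurable_fock_density.
have mf := md _ fd; have mfs := md _ (cdiff_sharp fd).
have d0 g p : (0 <= (fock_density alpha g p)%:E)%E.
  by rewrite lee_fin fock_density_ge0.
have -> : fock_integral f =
    (\int[mu]_x \int[mu]_y (fock_density alpha f (x, y))%:E)%E.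
  rewrite -(integral_rect_xy (A := setT) (B := setT)
    (g := fun p => (fock_density alpha f p)%:E))//.
  by rewrite setXTT.
rewrite !integral_rect_xy//; try exact: measurable_itv.
have msec g A : (forall z, cdiff g z) -> measurable A ->
    measurable_fun setT (fun x => \int[mu]_(y in A) (fock_density alpha g (x, y))%:E)%E.
  by move=> gd mA; exact: (measurable_section_integral mA (md _ gd)).
have sec0 g A x : (0 <= \int[mu]_(y in A) (fock_density alpha g (x, y))%:E)%E.
  exact: integral_ge0.
rewrite -ge0_integralD//; last 2 first.
- by apply: msec => //; exact: measurable_itv.
- by apply: msec; [exact: cdiff_sharp|exact: measurable_itv].
apply: le_integral_nonneg => x _; first exact: sec0.
have mx : measurable_fun setT (fun y : R => (fock_density alpha f (x, y))%:E).
  by apply: measurableT_comp mf _; exact: measurable_pair1.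
have mxs : measurable_fun setT (fun y : R => (fock_density alpha (sharp f) (x, y))%:E).
  by apply: measurableT_comp mfs _; exact: measurable_pair1.
rewrite -(setUv `[0, +oo[%classic) ge0_integral_setU//; last 3 first.
- by apply: measurableC; exact: measurable_itv.
- by rewrite setUv.
- by apply/disj_setPS => y [].
apply: leeD => //.
have E y : fock_density alpha f (x, y) = fock_density alpha (sharp f) (x, 0 - y).
  by rewrite fock_density_sharp sub0r opprK.
under eq_integral do rewrite E.
have refl (y : R) : (~` `[0, +oo[%classic) y -> `[0, +oo[%classic (0 - y).
  by rewrite /= !in_itv/= !andbT => /negP; rewrite -ltNge; lra.
have mhalf : measurable (`[0, +oo[%classic : set R) by exact: measurable_itv.
exact: le_integral_reflection mhalf mxs _ refl.
Qed.

(** The Hardy bounds [M] and [Ms] matter only through their finiteness. Both half-planes contribute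
    the same multiple of the same integral, because [f] and [sharp f] have equal modulus on the real
    line. *)
Lemma fock_integral_le f (M Ms : R) : (forall z, cdiff f z) ->
  (forall y, 0 < y ->
    (\int[mu]_x (cabs (f (x +i* y) / G (x +i* y)) ^+ 2)%:E <= M%:E)%E) ->
  (forall y, 0 < y ->
    (\int[mu]_x (cabs (sharp f (x +i* y) / G (x +i* y)) ^+ 2)%:E <= Ms%:E)%E) ->
  (fock_integral f <= (2 * upper_bound_cst alpha)%:E * real_line_integral f)%E.
Proof.
move=> fd fM fMs; apply: le_trans (fock_integral_split fd) _.
apply: le_trans (leeD (upper_half_plane_bound alpha_gt0 fd fM)
  (upper_half_plane_bound alpha_gt0 (cdiff_sharp fd) fMs)) _.
rewrite -/(real_line_integral _) -/(real_line_integral _) real_line_integral_sharp.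
have := real_line_integral_ge0 f.
move=> I0; rewrite -ge0_muleDl ?lee_fin ?upper_bound_cst_ge0//.
by rewrite -EFinD (_ : _ + _ = 2 * upper_bound_cst alpha)//; ring.
Qed.

Lemma hardy_bound f : (forall z, cdiff f z) -> forall y, 0 <= y ->
  (\int[mu]_x (cabs (f (x +i* y) / G (x +i* y)) ^+ 2)%:E <=
   (line_bound_cst alpha)%:E * fock_integral f)%E.
Proof.
move=> fd y y0; apply: le_trans (line_bound alpha_gt0 fd y).
rewrite le_eqVlt; apply/orP; left; apply/eqP; apply: eq_integral => x _.
by rewrite /line_density ger0_norm// cabsM exprMn.
Qed.

Lemma hardy_bound_sharp f : (forall z, cdiff f z) -> forall y, 0 <= y ->
  (\int[mu]_x (cabs (sharp f (x +i* y) / G (x +i* y)) ^+ 2)%:E <=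
   (line_bound_cst alpha)%:E * fock_integral f)%E.
Proof.
move=> fd y y0; apply: le_trans (line_bound alpha_gt0 fd (- y)).
rewrite le_eqVlt; apply/orP; left; apply/eqP; apply: eq_integral => x _.
by rewrite /line_density normrN ger0_norm// cabsM exprMn cabs_sharp.
Qed.

Lemma fock_normE f : fock_norm (weight alpha) f = sqrte (fock_integral f).
Proof. by []. Qed.

Lemma fock_norm_finite f :
  (fock_norm (weight alpha) f < +oo)%E <-> (fock_integral f < +oo)%E.
Proof.
rewrite fock_normE -!ge0_fin_numE ?sqrte_ge0 ?fock_integral_ge0//.
by rewrite sqrte_fin_num// fock_integral_ge0.
Qed.

Lemma cdiff_div_genfun f z : (forall z, cdiff f z) -> 0 < complex.Im z ->
  holomorphic_at (fun z => f z / G z) z.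
Proof.
move=> fd /ltW z0; apply/cdiffP; apply: cdiffM => //; apply: cdiffV.
  exact: canonical_product_neq0 (ratio_gt1 alpha_gt0) (genfun_cvg alpha_gt0) _ z0.
exact: canonical_product_cdiff (ratio_gt1 alpha_gt0) (genfun_cvg alpha_gt0) _ z0.
Qed.

Lemma fock_sub_de_branges f : fock_space (weight alpha) f -> de_branges G f.
Proof.
move=> [fe /fock_norm_finite fI]; have fd := entire_cdiff fe.
have Ifin : ((line_bound_cst alpha)%:E * fock_integral f)%E \is a fin_num.
  by rewrite fin_numM// ge0_fin_numE ?fock_integral_ge0.
split=> //; split; try by (move=> z; exact: cdiff_div_genfun).
- exists (fine ((line_bound_cst alpha)%:E * fock_integral f)%E) => y y0.
  by rewrite fineK//; apply: hardy_bound => //; exact: ltW.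
- by move=> z; apply: cdiff_div_genfun; exact: cdiff_sharp.
- exists (fine ((line_bound_cst alpha)%:E * fock_integral f)%E) => y y0.
  by rewrite fineK//; apply: hardy_bound_sharp => //; exact: ltW.
Qed.

Lemma de_branges_fock_integral_le f : de_branges G f ->
  (fock_integral f <= (2 * upper_bound_cst alpha)%:E * real_line_integral f)%E /\
  (real_line_integral f < +oo)%E.
Proof.
move=> [fe [_ [M fM]] [_ [Ms fMs]]]; have fd := entire_cdiff fe.
split; first exact: fock_integral_le fM fMs.
exact: le_lt_trans (boundary_norm_le alpha_gt0 fd fM) (ltry _).
Qed.

Lemma de_branges_sub_fock f : de_branges G f -> fock_space (weight alpha) f.
Proof.
move=> fG; have [fe _ _] := fG; split=> //; apply/fock_norm_finite.
have [Ile Bfin] := de_branges_fock_integral_le fG.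
have c0 : 0 <= 2 * upper_bound_cst alpha by rewrite mulr_ge0 ?upper_bound_cst_ge0.
apply: le_lt_trans Ile _; rewrite -ge0_fin_numE.
  by rewrite fin_numM// ge0_fin_numE// real_line_integral_ge0.
by rewrite mule_ge0 ?real_line_integral_ge0.
Qed.

End fock_versus_de_branges.

(** * From comparable integrals to equivalent norms *)

Section sqrt_comparison.
Context {R : realType}.

Lemma sqrte_le_scale (x y : \bar R) (K : R) : (0 <= y)%E -> 0 <= K ->
  (x <= K%:E * y)%E -> (sqrte x <= (Num.sqrt K)%:E * sqrte y)%E.
Proof.
move=> y0 K0 xy; rewrite -[(Num.sqrt K)%:E]/(sqrte K%:E) -sqrteM ?lee_fin//.
by rewrite lee_sqrt// mule_ge0.
Qed.

Lemma equivalent_sqrte (T : Type) (V : set T) (N1 N2 : T -> \bar R) (K1 K2 : R) :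
  (forall f, V f -> 0 <= N1 f)%E -> (forall f, V f -> 0 <= N2 f)%E ->
  (forall f, V f -> N2 f <= K1%:E * N1 f)%E ->
  (forall f, V f -> N1 f <= K2%:E * N2 f)%E ->
  equivalent_norms_on V (fun f => sqrte (N1 f)) (fun f => sqrte (N2 f)).
Proof.
move=> N10 N20 N21 N12.
(* The constants in [equivalent_norms_on] must be strictly positive, while [K1] and [K2] are
   arbitrary reals. *)
have pos (K : R) : 0 < `|K| + 1 by rewrite ltr_wpDl.
have enlarge (K : R) x : (0 <= x)%E -> (K%:E * x <= (`|K| + 1)%:E * x)%E.
  by move=> x0; apply: lee_wpmul2r => //; rewrite lee_fin ler_wpDr// ler_norm.
exists (Num.sqrt (`|K1| + 1))^-1, (Num.sqrt (`|K2| + 1)); split.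
- by rewrite invr_gt0 sqrtr_gt0.
- by rewrite sqrtr_gt0.
move=> f fV; split.
  have s0 : 0 < Num.sqrt (`|K1| + 1) by rewrite sqrtr_gt0.
  rewrite lee_pdivrMl//; apply: sqrte_le_scale; [exact: N10|exact: ltW|].
  by apply: le_trans (N21 f fV) _; apply: enlarge; exact: N10.
apply: sqrte_le_scale; [exact: N20|exact: ltW|].
by apply: le_trans (N12 f fV) _; apply: enlarge; exact: N20.
Qed.

End sqrt_comparison.

Theorem proposition2p8 (R : realType) (alpha : R) (halpha : 0 < alpha) :
  fock_space (weight alpha) = de_branges (genfun alpha) /\
  equivalent_norms_on (fock_space (weight alpha))
    (fock_norm (weight alpha)) (de_branges_norm (genfun alpha)).
Proof.
split.
  by apply/seteqP; split=> f;
    [exact: fock_sub_de_branges|exact: de_branges_sub_fock].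
(* Both norms are, by unfolding, square roots of these integrals, [x%:C] being [x +i* 0]. *)
apply: (@equivalent_sqrte _ _ _ (fock_integral alpha) (real_line_integral alpha)
  (line_bound_cst alpha) (2 * upper_bound_cst alpha)).
- by move=> f _; exact: fock_integral_ge0.
- by move=> f _; exact: real_line_integral_ge0.
- by move=> f [fe _]; exact: (hardy_bound halpha (entire_cdiff fe) (lexx 0)).
- by move=> f fV;
    have [] := de_branges_fock_integral_le halpha (fock_sub_de_branges halpha fV).
Qed.
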